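(* Let $\widehat{\mathscr T}=(T,\rho,\varepsilon)$ be a signed rooted tree, let $n=|n(\widehat{\mathscr T})|$ be the number of its non-root vertices, and let $H_{\widehat{\mathscr T}}\subset\mathbb R^n$ be the arboreal $\widehat{\mathscr T}$-front. Let $D(\mathbb R^n,H_{\widehat{\mathscr T}})$ be the group of germs at $0$ of diffeomorphisms of $\mathbb R^n$ preserving $H_{\widehat{\mathscr T}}$ as a front, i.e. as a subset along with its coorientation. Then the fibers of the natural map $D(\mathbb R^n,H_{\widehat{\mathscr T}})\to\mathrm{Aut}(\widehat{\mathscr T})$ are weakly contractible.
   Context: A signed rooted tree $\widehat{\mathscr T}=(T,\rho,\varepsilon)$ is a nonempty finite connected acyclic graph $T$, a root vertex $\rho$, and a sign $\pm1$ on each edge not adjacent to $\rho$; $n(\widehat{\mathscr T})$ is the set of non-root vertices. Vertices are partially ordered by $\alpha\le\beta$ iff the shortest path from $\beta$ to $\rho$ contains $\alpha$. A leaf is a non-root vertex with exactly one adjacent edge; $\ell(\widehat{\mathscr T})$ is the set of leaves. $\mathrm{Aut}(\widehat{\mathscr T})$ is the group of automorphisms of the tree preserving root and signs. Quadratic fronts. $h_0=0$, $h_i(x_1,\dots,x_i)=x_1-h_{i-1}(x_2,\dots,x_i)^2$, $h_{i,j}=h_{i-j}(x_{j+1},\dots,x_i)$ for $0\le j<i$. For signs $\varepsilon=(\varepsilon_0,\dots,\varepsilon_N)$ let $\sigma_\varepsilon(x_1,\dots,x_N)=(\varepsilon_1x_1,\dots,\varepsilon_Nx_N)$. For $0\le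 i\le N$, ${}^N\Gamma^\varepsilon_i\subset\mathbb R^{N+1}$ (coordinates $x_0,\dots,x_N$) is the hypersurface with corners $$x_0=\varepsilon_0\,(h_i\circ\sigma_\varepsilon)^2,\qquad \varepsilon_j\varepsilon_{j+1}\,h_{i,j}\circ\sigma_\varepsilon\le0\quad(0\le j\le i-1),$$ with the graphical coorientation (positive on $\partial_{x_0}$), and ${}^N\Gamma^\varepsilon=\bigcup_{i=0}^N{}^N\Gamma^\varepsilon_i$. Arboreal fronts. For a linear signed rooted tree $\mathcal A_{n+1}$ with vertices $0,1,\dots,n$, edges $[i,i+1]$, root $0$ and signs $a_{[1,2]},\dots,a_{[n-1,n]}$, put $\varepsilon=(a_{[1,2]},\dots,a_{[n-1,n]},1)$ and $H_{\mathcal A_{n+1}}={}^{n-1}\Gamma^\varepsilon\subset\mathbb R^n$ (empty if $n=0$); the coordinate called $x_i$ ($0\le i\le n-1$) above is the one indexed by the vertex $i+1$, and the smooth piece indexed by the vertex $i\in\{1,\dots,n\}$ is ${}^{n-1}\Gamma^\varepsilon_{i-1}$. For general $\widehat{\mathscr T}$ and a leaf $\beta$, let $\mathcal A_\beta$ be the full subtree on $\{\alpha\le\beta\}$ with restricted signs (a linear signed rooted tree), and let $\pi_\beta:\mathbb R^{n(\widehat{\mathscr T})}\to\mathbb R^{n(\mathcal A_\beta)}$ be the coordinate projection. The arboreal $\widehat{\mathscr T}$-front is $$H_{\widehat{\mathscr T}}=\bigcup_{\beta\in\ell(\widehat{\mathscr T})}\pi_\beta^{-1}(H_{\mathcal A_\beta})\subset\mathbb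 R^{n(\widehat{\mathscr T})}\cong\mathbb R^n,$$ with smooth pieces $H_\alpha=\pi_\beta^{-1}(H_{\mathcal A_\beta,\alpha})$, $\alpha\in n(\widehat{\mathscr T})$ ($\beta\ge\alpha$ any leaf), each cooriented. The natural map $D(\mathbb R^n,H_{\widehat{\mathscr T}})\to\mathrm{Aut}(\widehat{\mathscr T})$ sends a germ of diffeomorphism to the automorphism of the tree given by its permutation of the smooth pieces $H_\alpha$. The group of germs is considered with the $C^\infty$ topology; weak contractibility means that every family in the fiber parametrized by a sphere $S^k$ extends to a family in the fiber parametrized by the ball $B^{k+1}$. *)

(* Defs.v *)
From HB Require Import structures.
From mathcomp Require Import all_boot all_order all_algebra all_fingroup.
From mathcomp Require Import all_classical all_reals all_analysis.

Set Implicit Arguments.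
Unset Strict Implicit.
Unset Printing Implicit Defensive.

Import Order.TTheory GRing.Theory Num.Theory.
Import numFieldNormedType.Exports.
Local Open Scope classical_set_scope.
Local Open Scope ring_scope.

(* An edge is the two-element set of its endpoints.  [neg e] means that e     *)
(* carries the sign -1; [neg] is only ever read at edges avoiding the root,   *)
(* its other values are junk.                                                 *)
Record signed_rooted_tree := SignedRootedTree {
  vert :> finType;
  adj : rel vert;
  root : vert;
  neg : {set vert} -> bool;
  adj_sym : symmetric adj;
  adj_irr : irreflexive adj;
  adj_connected : forall x y, connect adj x y;
  adj_acyclic : forall c : seq vert, ucycle adj c -> (size c <= 2)%N
}.

Section Tree.
Variable T : signed_rooted_tree.

Definition nonroot := {a : T | a != root T}.

Definition shortest_path (x y : T) (p : seq T) : Prop :=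
  [/\ path (@adj T) x p, last x p = y &
      forall q, path (@adj T) x q -> last x q = y -> (size p <= size q)%N].

(* The shortest path from the root to b, without the root itself: these are   *)
(* the non-root vertices of the linear tree of all a <= b, in order.          *)
Definition root_path (b : T) : seq T :=
  xget [::] [set p | shortest_path (root T) b p].

Definition tree_le (a b : T) : bool := a \in root T :: root_path b.

Definition leaf (b : T) : bool :=
  (b != root T) && (#|[set a | adj b a]%SET| == 1%N).

Definition tree_aut (t : {perm T}) : Prop :=
  [/\ t (root T) = root T,
      forall a b, adj (t a) (t b) = adj a b &
      forall a b, adj a b -> a != root T -> b != root T ->
        neg [set t a; t b]%SET = neg [set a; b]%SET].

End Tree.

Section QuadraticFront.
Variable R : realType.

Fixpoint hq (s : seq R) : R :=
  if s is x :: s' then x - hq s' ^+ 2 else 0.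

Variables (N : nat) (eps : nat -> R).
Implicit Types (x : 'rV[R]_N.+1) (i j : nat).

(* h_{i,j} o sigma_eps; for j = 0 this is h_i o sigma_eps *)
Definition hsig i j x : R :=
  hq [seq eps k * x 0 (inord k) | k <- index_iota j.+1 i.+1].

Definition gamma_piece i : set 'rV[R]_N.+1 :=
  [set x : 'rV[R]_N.+1 | x 0 ord0 = eps 0%N * hsig i 0 x ^+ 2 /\
           forall j, (j < i)%N -> eps j * eps j.+1 * hsig i j x <= 0].

Definition gamma_front : set 'rV[R]_N.+1 :=
  \bigcup_(i in [set i | (i <= N)%N]) gamma_piece i.

(* gamma_piece i is part of the graph {gamma_fun i = 0}; since the derivative *)
(* of gamma_fun i along x_0 is 1, its graphical coorientation is the side on  *)
(* which gamma_fun i increases.                                               *)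
Definition gamma_fun i x : R := x 0 ord0 - eps 0%N * hsig i 0 x ^+ 2.

End QuadraticFront.

Section ArborealFront.
Variables (R : realType) (T : signed_rooted_tree).

Local Notation V := ('rV[R]_#|{: nonroot T}|).

Definition coord (x : V) (a : T) : R :=
  if insub a is Some a' then x 0 (enum_rank (a' : nonroot T)) else 0.

Implicit Types (b a : T).

(* If v_1, ..., v_m are the non-root vertices of the linear tree of b, then   *)
(* N = m - 1, the quadratic front coordinate x_k is the one of v_{k+1}, and   *)
(* eps_k is the sign of the edge [v_{k+1}, v_{k+2}] for k < N, with eps_N = 1.*)
Definition lin_dim b : nat := (size (root_path b)).-1.

Definition lin_sign b (k : nat) : R :=
  if (k < lin_dim b)%N
  then (-1) ^+ neg [set nth (root T) (root_path b) k;
                        nth (root T) (root_path b) k.+1]%SET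
  else 1.

Definition lin_proj b (x : V) : 'rV[R]_(lin_dim b).+1 :=
  \row_k coord x (nth (root T) (root_path b) k).

Definition front : set V :=
  \bigcup_(b in [set b : T | leaf b])
    (@lin_proj b @^-1` gamma_front (lin_sign b)).

Definition lin_piece b a : set V :=
  @lin_proj b @^-1` gamma_piece (lin_sign b) (index a (root_path b)).

Definition lin_piece_fun b a : V -> R :=
  gamma_fun (lin_sign b) (index a (root_path b)) \o @lin_proj b.

(* lin_piece b a is the same set for all leaves b >= a. *)
Definition smooth_piece a : set V :=
  \bigcup_(b in [set b : T | leaf b && tree_le a b]) lin_piece b a.

(* The cooriented tangent hyperplanes of the front at x, each represented by  *)
(* its open half space of positive vectors.                                   *)
Definition coorientation (x : V) : set (set V) :=
  [set P | exists b a, [/\ leaf b, a != root T, tree_le a b, lin_piece b a x &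
     P = [set v : V | 0 < 'D_v (lin_piece_fun b a) x]]].

End ArborealFront.

Section Germs.
Variables (R : realType) (n : nat).
Local Notation V := ('rV[R]_n).

(* Germs at 0 are handled through representatives V -> V; all the notions     *)
(* below except smooth_on and smooth_family are invariant under germ_eq.      *)
Definition germ_eq (f g : V -> V) : Prop := \forall x \near (0 : V), f x = g x.

Definition iter_derive (vs : seq V) (f : V -> V) : V -> V :=
  foldr (fun v g => fun x => 'D_v g x) f vs.

Definition smooth_on (U : set V) (f : V -> V) : Prop :=
  forall vs x, U x -> differentiable (iter_derive vs f) x.

Definition smooth_germ (f : V -> V) : Prop :=
  exists U : set V, [/\ open U, U 0 & smooth_on U f].

Definition diffeo_germ (f : V -> V) : Prop :=
  [/\ f 0 = 0, smooth_germ f &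
      exists g : V -> V,
        [/\ g 0 = 0, smooth_germ g, germ_eq (g \o f) id & germ_eq (f \o g) id]].

(* A family of smooth germs, continuous for the C^oo topology: on a common    *)
(* neighbourhood of 0, all partial derivatives are jointly continuous.        *)
Definition smooth_family (m : nat) (K : set 'rV[R]_m)
    (F : 'rV[R]_m -> V -> V) : Prop :=
  exists U : set V,
    [/\ open U, U 0, forall z, K z -> smooth_on U (F z) &
        forall vs, {within K `*` U,
          continuous (fun p : 'rV[R]_m * V => iter_derive vs (F p.1) p.2)}].

Definition unit_sphere (m : nat) : set 'rV[R]_m :=
  [set z : 'rV[R]_m | \sum_i z 0 i ^+ 2 = 1].

Definition unit_ball (m : nat) : set 'rV[R]_m :=
  [set z : 'rV[R]_m | \sum_i z 0 i ^+ 2 <= 1].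

(* The sphere S^{m-1} and the ball B^m in R^m; for m = 0 the sphere is empty  *)
(* and the condition says that S is nonempty.                                 *)
Definition weakly_contractible (S : set (V -> V)) : Prop :=
  forall (m : nat) (F : 'rV[R]_m -> V -> V),
    smooth_family (@unit_sphere m) F ->
    (forall z, unit_sphere z -> S (F z)) ->
    exists G : 'rV[R]_m -> V -> V,
      [/\ smooth_family (@unit_ball m) G,
          forall z, unit_ball z -> S (G z) &
          forall z, unit_sphere z -> germ_eq (G z) (F z)].

End Germs.

Section FrontDiffeos.
Variables (R : realType) (T : signed_rooted_tree).
Local Notation V := ('rV[R]_#|{: nonroot T}|).

Definition preserves_front (f : V -> V) : Prop :=
  \forall x \near (0 : V),
    (front x <-> front (f x)) /\
    (forall P : set V, coorientation x P <-> coorientation (f x) ('d f x @` P)).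

Definition front_diffeo : set (V -> V) :=
  [set f | diffeo_germ f /\ preserves_front f].

(* (f, t) is in the graph of the natural map to the automorphism group: the   *)
(* germ of f permutes the germs at 0 of the smooth pieces as t does.          *)
Definition permutes_pieces (f : V -> V) (t : {perm T}) : Prop :=
  forall a : T, a != root T ->
    \forall x \near (0 : V), smooth_piece a x <-> smooth_piece (t a) (f x).

Definition natural_map_fiber (t : {perm T}) : set (V -> V) :=
  [set f | front_diffeo f /\ permutes_pieces f t].

End FrontDiffeos.

(* Main.v *)
(* The front is invariant under the weighted dilations [dil r], where the      *)
(* weight of a coordinate doubles at each step towards the root.  On the      *)
(* pieces of all ancestors of [a] (with [a] included) simultaneously, exactly *)
(* the coordinates of these ancestors vanish; hence, for [f] in the fiber of  *)
(* [t], the component [f_(t a)] vanishes on this subspace, and its Taylor     *)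
(* expansion at 0 has no term of weight less than that of [a] and only one of *)
(* that weight, namely [c_a x_a].  So [dil r^-1 o f o dil r] tends as [r -> 0] *)
(* to the linear map [x_(t a) := c_a x_a], together with all derivatives, and *)
(* the invariance of the front forces [c_a > 0] and [c_p = c_a ^ 2] for the   *)
(* parent [p] of [a].  Such diagonal maps preserve the front themselves, so   *)
(* correcting by [c ^ (r - 1)] contracts the fiber to the permutation of the  *)
(* coordinates by [t], uniformly over a sphere of parameters; this fills the  *)
(* ball.                                                                      *)

Require Import Defs.
From HB Require Import structures.
From mathcomp Require Import all_boot all_order all_algebra all_fingroup.
From mathcomp Require Import all_classical all_reals all_analysis.
From mathcomp Require Import ring lra zify.

Set Implicit Arguments.
Unset Strict Implicit.
Unset Printing Implicit Defensive.

Import Order.TTheory GRing.Theory Num.Theory.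
Import numFieldNormedType.Exports.
Local Open Scope classical_set_scope.
Local Open Scope ring_scope.


(** * Signed rooted trees *)

(** The contraction is a weighted rescaling at the origin. Since [weight] doubles at each step
    towards the root, x_p and x_a^2 scale alike for every edge [p,a], and the dilations [dil]
    preserve all pieces and their coorientations. They belong to the linear symmetries [symm t mu]
    with [balanced mu]. The pieces enter through the recursive expressions [phi] and [corner] along
    root paths, which depend on no choice of a leaf ([lin_pieceE], [coorientationE]).

    Let f lie in the fiber of t. A point on the pieces of all a' <= a has zero coordinates at all
    these a' ([on_pieces_coord0]), so f_(t a) vanishes wherever these coordinates do
    ([vanish_near]). Each Taylor term of f_(t a) therefore contains some x_a' with a' <= a, whose
    weight is at least that of a; hence c_a x_a is the only term of weight at most [weight a]
    ([partial_vanish]). It follows that dil_r^-1 f dil_r tends to the linear map x_(t a) := c_a x_a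
    with all derivatives, uniformly over compact families ([uniform_scaling]).

    The coefficients satisfy c_a > 0 and c_p = c_a^2 ([lead_balanced]). Invertibility of f gives c_a
    <> 0 ([lead_neq0]); the image of a test point on the piece of a gives c_p = c_a^2 and c_a >= 0
    when a has a non-root parent p ([lead_edge]); next to the root the sign comes from the
    coorientation ([lead_top]).

    Hence c^(r-1) is balanced as well, and multiplying by it keeps the path in the fiber and moves
    its limit to the coordinate permutation by t, which no longer depends on f. For a family over
    the sphere, [cone] follows this path along each radius with r the norm of z. Continuity of all
    derivatives is [cone_cvg0] at the centre and [cone_cvg_pos] elsewhere. *)

Section TreePaths.
Variable T : signed_rooted_tree.
Implicit Types (a b x y : T) (p q : seq T).
Local Notation root := (Defs.root T).

(* Two simple paths with the same ends which first diverge at [x] and next    *)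
(* meet at [z] bound a cycle.                                                 *)
Lemma simple_path_unique x p q :
  path (@adj T) x p -> path (@adj T) x q -> uniq (x :: p) -> uniq (x :: q) ->
  last x p = last x q -> p = q.
Proof.
elim: p x q => [|a p IH] x [|b q] //.
- by move=> _ _ _ /andP[xq _] /= xE; rewrite xE mem_last in xq.
- by move=> _ _ /andP[xp _] _ /= xE; rewrite -xE mem_last in xp.
have [<-|ab] := eqVneq a b.
  move=> /andP[_ ap] /andP[_ aq] /andP[_ up] /andP[_ uq] /= lE.
  by rewrite (IH a q).
move=> px qx ux vx lE; exfalso.
have [p1 [z [p2 [pE zq p1q]]]] : exists p1 z p2,
    [/\ a :: p = p1 ++ z :: p2, z \in b :: q & ~~ has [in b :: q] p1].
  have : has [in b :: q] (a :: p).
    apply/hasP; exists (last a p); first exact: mem_last.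
    by move: lE => /= ->; exact: mem_last.
  case/split_find => z p1 p2 zq p1q.
  by exists p1, z, p2; rewrite cat_rcons.
have [q1 [q2 qE]] : exists q1 q2, b :: q = q1 ++ z :: q2.
  by case/splitPr: zq => q1 q2; exists q1, q2.
have gt0 : (0 < size p1 + size q1)%N.
  case: p1 q1 pE qE {p1q} => [|? ?] [|? ?] //= [aE _] [bE _].
  by rewrite aE bE eqxx in ab.
move: px qx ux vx p1q; rewrite pE qE !cat_path /=.
move=> /and3P[px pz _] /and3P[qx qz _] ux vx p1q.
have cyc : path.cycle (@adj T) (x :: p1 ++ z :: rev q1).
  rewrite /= rcons_cat cat_path px /= pz /= -rev_cons.
  have := rev_path (@adj T) x (rcons q1 z).
  rewrite last_rcons belast_rcons => ->.
  by rewrite (eq_path (e' := @adj T)) ?rcons_path ?qx // => u v; exact: adj_sym.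
have un : uniq (x :: p1 ++ z :: rev q1).
  move: ux vx; rewrite /= !cat_uniq /= !mem_cat !inE !negb_or !mem_rev rev_uniq.
  move=> /andP[/and3P[-> -> _] /and3P[-> /andP[-> _] _]].
  move=> /andP[/and3P[-> _ _] /and3P[-> /andP[-> _] _]] /=; rewrite andbT.
  rewrite has_rev; apply: contra p1q => /hasP[y yq yp].
  by apply/hasP; exists y => //=; rewrite mem_cat yq.
have /adj_acyclic : ucycle (@adj T) (x :: p1 ++ z :: rev q1) by rewrite /ucycle cyc.
by rewrite /= size_cat /= size_rev addnS !ltnS leqNgt gt0.
Qed.

(** Connectedness provides a simple path. Any other walk shortens to a simple path with the same
    ends, which is that one by uniqueness, so [xget] does not fall back on its default. *)
Lemma root_path_shortest b : shortest_path root b (root_path b).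
Proof.
suff : exists p, shortest_path root b p by
  exact: (@xgetPex _ [::] [set p | shortest_path root b p]).
have /connectP[p0 p0P ->] := adj_connected root b.
case/shortenP: p0P => p pP pu _; exists p; split=> // q qP.
case/shortenP: (qP) => q' q'P q'u sub /esym lE.
rewrite (simple_path_unique pP q'P pu q'u lE).
by apply: uniq_leq_size => //; case/andP: q'u.
Qed.

Lemma root_path_path b : path (@adj T) root (root_path b).
Proof. by case: (root_path_shortest b). Qed.

Lemma root_path_last b : last root (root_path b) = b.
Proof. by case: (root_path_shortest b). Qed.

(** Loop erasure gives a simple path inside [root_path b], by minimality of at least the same
    length; a repetition, or the root as a member, would contradict the count. *)
Lemma root_path_uniq b : uniq (root :: root_path b).
Proof.
have [pP lE min] := root_path_shortest b.
case/shortenP: (pP) lE => p p'P pu sub bE.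
have szp : (size (root_path b) <= size p)%N by apply: min.
rewrite /=; apply/andP; split; last first.
  by apply: leq_size_uniq szp => //; case/andP: pu.
apply/negP => r0; have := uniq_leq_size pu (s2 := root_path b).
rewrite /= ltnNge szp => /(_ _)/negP; apply=> // y.
by rewrite inE => /predU1P[->//|/sub].
Qed.

Lemma root_pathE p :
  path (@adj T) root p -> uniq (root :: p) -> root_path (last root p) = p.
Proof.
move=> pP pu; apply: (@simple_path_unique root) => //.
- exact: root_path_path.
- exact: root_path_uniq.
- exact: root_path_last.
Qed.

Lemma root_path_root : root_path root = [::].
Proof. exact: (@root_pathE [::]). Qed.

Lemma root_path_nonroot a b : a \in root_path b -> a != root.
Proof. by move=> ab; have /andP[+ _] := root_path_uniq b; apply: contraNneq => <-. Qed.

Lemma root_path_rcons a : a != root ->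
  exists2 p, root_path a = rcons p a & root_path (last root p) = p.
Proof.
move=> a0; case: (lastP (root_path a)) (root_path_last a) (root_path_path a)
  (root_path_uniq a) => [/= aE|p c]; first by rewrite aE eqxx in a0.
rewrite last_rcons => -> pP pu; exists p => //; apply: root_pathE.
  by move: pP; rewrite rcons_path => /andP[].
by move: pu; rewrite -rcons_cons rcons_uniq => /andP[].
Qed.

Lemma root_path_self a : a != root -> a \in root_path a.
Proof. by case/root_path_rcons => p -> _; rewrite mem_rcons mem_head. Qed.

Lemma root_path_prefix a p q : root_path a = p ++ q -> root_path (last root p) = p.
Proof.
move=> E; apply: root_pathE.
  by have := root_path_path a; rewrite E cat_path => /andP[].
by have := root_path_uniq a; rewrite E -cat_cons cat_uniq => /andP[].
Qed.

Lemma root_path_mem a b : a \in root_path b ->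
  exists q, root_path b = root_path a ++ q.
Proof.
move=> ab; case/splitPr E : _ / ab => [p q].
exists q; rewrite -cat_rcons; congr cat.
by rewrite -(@root_path_prefix b (rcons p a) q) ?last_rcons // cat_rcons.
Qed.

Lemma root_path_take a b : a \in root_path b ->
  root_path a = take (index a (root_path b)).+1 (root_path b).
Proof.
move=> /[dup] /root_path_nonroot a0 /root_path_mem[q ->].
have [p E _] := root_path_rcons a0; rewrite E.
have : a \notin p by have := root_path_uniq a; rewrite E /= rcons_uniq => /and3P[].
move=> /negPf ap; have -> : index a (rcons p a ++ q) = size p.
  by rewrite cat_rcons index_cat ap /= eqxx addn0.
by rewrite take_size_cat ?size_rcons.
Qed.

Lemma root_path_edge a p c d q : root_path a = p ++ c :: d :: q -> adj c d.
Proof.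
move=> E; have := root_path_path a.
by rewrite E cat_path /= => /and4P[].
Qed.

Lemma tree_leE a b : a != root -> tree_le a b = (a \in root_path b).
Proof. by move=> a0; rewrite /tree_le inE (negPf a0). Qed.

Lemma root_path_le a b c : a \in root_path b -> b \in root_path c -> a \in root_path c.
Proof. by move=> ab /root_path_mem[q ->]; rewrite mem_cat ab. Qed.

Lemma root_path_antisym a b : a \in root_path b -> b \in root_path a -> a = b.
Proof.
move=> /root_path_mem[p E] /root_path_mem[q]; rewrite E -catA -[LHS]cats0.
move=> /(congr1 size); rewrite !size_cat /= => /addnI/eqP.
rewrite eq_sym addn_eq0 !size_eq0 => /andP[/eqP p0 _].
by rewrite -(root_path_last a) -(root_path_last b) E p0 cats0.
Qed.

(** A deepest [b] above [a] works: a neighbour of [b] on its root path must be the parent, and one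
    off the path would extend it to a deeper vertex. *)
Lemma leaf_above a : a != root -> exists2 b, leaf b & a \in root_path b.
Proof.
move=> a0.
have [b ab bmax] : exists2 b, a \in root_path b &
    forall c, a \in root_path c -> (size (root_path c) <= size (root_path b))%N.
  case: (@arg_maxnP T a (fun b => a \in root_path b) (fun b => size (root_path b))).
    exact: root_path_self.
  by move=> b ab bmax; exists b.
exists b => //; have b0 : b != root.
  by apply: contraTneq ab => ->; rewrite root_path_root.
rewrite /leaf b0 /=.
have [p E pE] := root_path_rcons b0.
have bp : adj b (last root p).
  by have := root_path_path b; rewrite E rcons_path adj_sym => /andP[].
apply/cards1P; exists (last root p); apply/setP => c; rewrite !inE.
apply/idP/eqP => [bc|->//].
have [cp|cp] := boolP (c \in root :: root_path b).
  have bc' : c != b by apply: contraTneq bc => ->; rewrite adj_irr.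
  have [q Eq] : exists q, p = root_path c ++ q.
    move: cp; rewrite E inE mem_rcons inE (negPf bc') /=.
    case/orP => [/eqP->|cp]; first by exists p; rewrite root_path_root.
    by have := cp; rewrite -pE => /root_path_mem[q]; rewrite pE => ->; exists q.
  have : root_path (last root (rcons (root_path c) b)) = rcons (root_path c) b.
    apply: root_pathE.
      by rewrite rcons_path root_path_path root_path_last adj_sym.
    rewrite -rcons_cons rcons_uniq root_path_uniq andbT.
    have := root_path_uniq b; rewrite E Eq -rcons_cons rcons_uniq -cat_cons.
    by rewrite mem_cat negb_or => /andP[/andP[]].
  by rewrite last_rcons E => /rcons_inj[->]; rewrite root_path_last.
have /bmax : a \in root_path (last root (rcons (root_path b) c)).
  rewrite root_pathE ?mem_rcons ?inE ?ab ?orbT //.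
    by rewrite rcons_path root_path_path root_path_last.
  by rewrite -rcons_cons rcons_uniq cp root_path_uniq.
rewrite root_pathE ?size_rcons ?ltnn //.
  by rewrite rcons_path root_path_path root_path_last.
by rewrite -rcons_cons rcons_uniq cp root_path_uniq.
Qed.

End TreePaths.

Section TreeAutomorphisms.
Variables (T : signed_rooted_tree) (t : {perm T}).
Hypothesis tP : tree_aut t.
Implicit Types (a b : T).

Lemma root_path_aut a : root_path (t a) = map t (root_path a).
Proof.
have [t0 tadj _] := tP.
have <- : last (Defs.root T) (map t (root_path a)) = t a.
  by rewrite -{1}t0 last_map root_path_last.
apply: root_pathE; last first.
  by have := root_path_uniq a; rewrite -(map_inj_uniq (@perm_inj _ t)) /= t0.
rewrite -{1}t0 path_map (eq_path (e' := @adj T)) ?root_path_path //.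
Qed.

Lemma nonroot_aut a : (t a != Defs.root T) = (a != Defs.root T).
Proof. by have [t0 _ _] := tP; rewrite -{1}t0 (inj_eq perm_inj). Qed.

Lemma tree_aut_inv : tree_aut t^-1.
Proof.
have [t0 tadj tneg] := tP; split.
- by rewrite -{1}t0 permK.
- by move=> a b; rewrite -tadj !permKV.
- move=> a b ab a0 b0.
  have ti c : c != Defs.root T -> t^-1%g c != Defs.root T.
    by rewrite -[t^-1%g c != _]nonroot_aut permKV.
  by rewrite -tneg ?ti ?permKV // -tadj !permKV.
Qed.

End TreeAutomorphisms.


(** * Smooth pieces of the front *)

Section IntrinsicPieces.
Variables (R : realType) (T : signed_rooted_tree).
Local Notation V := ('rV[R]_#|{: nonroot T}|).
Local Notation root := (Defs.root T).
Implicit Types (a b : T) (s : seq T) (x : V).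

Definition edge_sign a b : R := (-1) ^+ neg [set a; b]%SET.

Lemma edge_sign_sqr a b : edge_sign a b * edge_sign a b = 1.
Proof. by rewrite -expr2 sqrr_sign. Qed.

(* With [h_{i,j}] as in the definition of the quadratic fronts, [phi] of the  *)
(* vertices [j, ..., i] of a chain is [eps_j (h_{i,j-1} o sigma_eps)], which  *)
(* no longer depends on [eps_i].                                              *)
Fixpoint phi s x : R :=
  if s is a :: s' then Defs.coord x a - edge_sign a (head a s') * phi s' x ^+ 2 else 0.

(** At the last vertex the condition reads 0 <= 0, because [phi [::]] is 0; the others are the
    inequalities for 0 <= j <= i-1. *)
Fixpoint corner s x : bool :=
  if s is a :: s' then (edge_sign a (head a s') * phi s' x <= 0) && corner s' x
  else true.

(** The smooth piece of [a] read off its root path alone, without a leaf above [a]. *)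
Definition on_piece a x : bool :=
  (phi (root_path a) x == 0) && corner (root_path a) x.

Lemma lin_dimS b : b != root -> (lin_dim b).+1 = size (root_path b).
Proof. by case/root_path_rcons => p E _; rewrite /lin_dim E size_rcons. Qed.

Lemma lin_sign_sqr b k : lin_sign R b k * lin_sign R b k = 1.
Proof. by rewrite /lin_sign; case: ifP => _; rewrite ?mulr1 // -expr2 sqrr_sign. Qed.

(** Downward induction on [j]. The sign inside the square disappears as eps_(j+1)^2 = 1, and the
    factor eps_j taken out is the sign of the edge that [phi] puts before the square. *)
Lemma hq_phi b x i j : b != root -> (i <= lin_dim b)%N -> (j <= i.+1)%N ->
  hq [seq lin_sign R b k * lin_proj b x 0 (inord k) | k <- index_iota j i.+1] =
  lin_sign R b j * phi (drop j (take i.+1 (root_path b))) x.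
Proof.
move=> b0 ib; have sz := lin_dimS b0.
have szt : size (take i.+1 (root_path b)) = i.+1 by rewrite size_takel // -sz ltnS.
move: {2}(i.+1 - j)%N (erefl (i.+1 - j)%N) => d.
elim: d j => [|d IH] j dE ji.
  have -> : j = i.+1 by apply/eqP; rewrite eqn_leq ji -subn_eq0 dE.
  by rewrite /index_iota subnn /= drop_oversize ?szt //= mulr0.
have {}ji : (j < i.+1)%N by rewrite -subn_gt0 dE.
rewrite /index_iota dE /= -[d]/(d.+1.-1) -dE -subnS -/(index_iota j.+1 i.+1).
rewrite IH ?subnS ?dE // (drop_nth root (n := j)) ?szt //= nth_take //.
rewrite mxE inordK; last by rewrite (leq_trans ji).
have [ij|ij] := leqP i j.
  have -> : drop j.+1 (take i.+1 (root_path b)) = [::] by rewrite drop_oversize ?szt.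
  by rewrite /= !(mulr0, expr0n, subr0).
have -> : head (nth root (root_path b) j) (drop j.+1 (take i.+1 (root_path b))) =
          nth root (root_path b) j.+1.
  by rewrite (drop_nth root) ?szt //= nth_take.
rewrite exprMn [lin_sign R b j.+1 ^+ 2]expr2 lin_sign_sqr.
rewrite mulrBr; congr (_ - _).
rewrite mul1r mulrA; set e := (X in _ = X * _); suff -> : e = 1 by rewrite mul1r.
rewrite /e /lin_sign (leq_trans ij ib).
exact: edge_sign_sqr.
Qed.

Lemma lin_piece_funE b a : a \in root_path b ->
  lin_piece_fun b a = phi (root_path a) :> (V -> R).
Proof.
move=> ab; apply/funext => x.
have b0 : b != root by apply: contraTneq ab => ->; rewrite root_path_root.
have ib : (index a (root_path b) <= lin_dim b)%N by rewrite -ltnS lin_dimS ?index_mem.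
rewrite /lin_piece_fun /gamma_fun /= /hsig (root_path_take ab).
have := hq_phi x b0 ib (leq0n _); rewrite drop0 /index_iota subn0 /=.
rewrite subSS subn0 => E.
rewrite -[RHS]mul1r -(lin_sign_sqr b 0) -mulrA -E mulrBr [in RHS]mulrA lin_sign_sqr mul1r.
by congr (lin_proj b x 0 _ - _); apply: val_inj; rewrite /= inordK.
Qed.

Lemma corner_drop s x :
  corner s x <-> forall j, (j < size s)%N ->
    edge_sign (nth root s j) (head (nth root s j) (drop j.+1 s)) * phi (drop j.+1 s) x <= 0.
Proof.
elim: s => [|a s IH] //=; split.
  by move=> /andP[H /IH IHs] [|j] //= js; rewrite ?drop0 //; apply: IHs.
move=> H; apply/andP; split; first by have := H 0%N isT; rewrite /= drop0.
by apply/IH => j js; exact: (H j.+1).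
Qed.

Lemma lin_pieceE b a x : a \in root_path b -> lin_piece b a x <-> on_piece a x.
Proof.
move=> ab; have b0 : b != root by apply: contraTneq ab => ->; rewrite root_path_root.
have ib : (index a (root_path b) <= lin_dim b)%N by rewrite -ltnS lin_dimS ?index_mem.
have := lin_piece_funE ab => /(congr1 (fun f => f x)).
rewrite /lin_piece_fun /gamma_fun /= => phiE.
rewrite /lin_piece /gamma_piece /on_piece /= -phiE subr_eq0.
have cE : corner (root_path a) x <-> forall j, (j < index a (root_path b))%N ->
    lin_sign R b j * lin_sign R b j.+1 *
      hsig (lin_sign R b) (index a (root_path b)) j (lin_proj b x) <= 0.
  rewrite corner_drop (root_path_take ab).
  set i := index a (root_path b) in ib *.
  have szt : size (take i.+1 (root_path b)) = i.+1 by rewrite size_takel // -lin_dimS.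
  have key j : (j < i)%N -> edge_sign (nth root (take i.+1 (root_path b)) j)
     (head (nth root (take i.+1 (root_path b)) j) (drop j.+1 (take i.+1 (root_path b)))) *
     phi (drop j.+1 (take i.+1 (root_path b))) x =
     lin_sign R b j * lin_sign R b j.+1 * hsig (lin_sign R b) i j (lin_proj b x).
    move=> ji; rewrite /hsig hq_phi ?(leqW ji) // mulrA -[_ * _ * lin_sign R b j.+1]mulrA.
    rewrite lin_sign_sqr mulr1; congr (_ * _).
    rewrite (drop_nth root) ?szt //= !nth_take //; last by rewrite ltnW.
    by rewrite /lin_sign (leq_trans ji ib).
  rewrite szt; split => H j ji; first by rewrite -key // H // ltnW.
  move: ji; rewrite ltnS leq_eqVlt => /predU1P[->|ji]; last by rewrite key // H.
  (* The extra index j = i of [corner] is the trivial condition at the last vertex. *)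
  by rewrite (@drop_oversize _ i.+1) ?szt //= mulr0.
by split=> [[/eqP-> /cE->]|/andP[/eqP-> /cE]].
Qed.

Lemma smooth_pieceE a x : a != root -> smooth_piece a x <-> on_piece a x.
Proof.
move=> a0; split=> [[b /= /andP[_]]|ax]; first by rewrite tree_leE // => /lin_pieceE->.
by have [b lb ab] := leaf_above a0; exists b; rewrite /= ?lb ?tree_leE //; apply/lin_pieceE.
Qed.

Lemma frontE x : front x <-> exists2 a, a != root & on_piece a x.
Proof.
split=> [[b /= lb [i ib ix]]|[a a0 ax]].
  have b0 : b != root by case/andP: lb.
  have ib' : (i < size (root_path b))%N by rewrite -lin_dimS.
  have ab := mem_nth root ib'; exists (nth root (root_path b) i).
    exact: root_path_nonroot ab.
  apply/(lin_pieceE x ab); rewrite /lin_piece /= index_uniq //.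
  by have /andP[] := root_path_uniq b.
have [b lb ab] := leaf_above a0; exists b => //.
exists (index a (root_path b)); last exact/(lin_pieceE x ab).
by rewrite /= -ltnS lin_dimS ?index_mem //; case/andP: lb.
Qed.

Lemma coorientationE x (P : set V) : coorientation x P <->
  exists a, [/\ a != root, on_piece a x &
    P = [set v : V | 0 < 'D_v (phi (root_path a)) x]].
Proof.
split=> [[b [a [lb a0]]]|[a [a0 ax ->]]].
  by rewrite tree_leE // => ab /(lin_pieceE x ab) ax ->; exists a; rewrite lin_piece_funE.
have [b lb ab] := leaf_above a0; exists b, a.
by rewrite tree_leE // lin_piece_funE //; split=> //; exact/(lin_pieceE x ab).
Qed.

End IntrinsicPieces.


(** * Linear symmetries of the front *)

Section LinearMaps.
Variables (R : realType) (n : nat).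

Lemma linear_rV_differentiable (W : normedModType R) (f : {linear 'rV[R]_n -> W}) x :
  differentiable f x.
Proof.
have -> : (f : _ -> W) = \sum_j (fun x : 'rV[R]_n => x 0 j *: f (delta_mx 0 j)).
  apply/funext => y; rewrite fct_sumE {1}[y]row_sum_delta linear_sum.
  by apply: eq_bigr => j _; rewrite linearZ.
apply: differentiable_sum => j; apply: differentiableZl.
exact: differentiable_coord.
Qed.

Lemma linear_rV_continuous (W : normedModType R) (f : {linear 'rV[R]_n -> W}) :
  continuous f.
Proof. by move=> x; exact/differentiable_continuous/linear_rV_differentiable. Qed.

Lemma linear_rV_diff (W : normedModType R) (f : {linear 'rV[R]_n -> W}) x :
  'd f x = f :> (_ -> W).
Proof. by rewrite diff_lin //; exact: linear_rV_continuous. Qed.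

(** The two difference quotients are the same function of the increment, so the identity holds for
    arbitrary [g]. *)
Lemma derive_comp_linear (V W : normedModType R) (f : {linear 'rV[R]_n -> V})
    (g : V -> W) x v : 'D_v (g \o f) x = 'D_(f v) g (f x).
Proof.
rewrite /derive; set d := (fun _ : R => _); set d' := (fun _ : R => _).
suff -> : d = d' by [].
by apply/funext => h; rewrite /d /d' /= linearP.
Qed.

End LinearMaps.

Section Symmetries.
Variables (R : realType) (T : signed_rooted_tree).
Local Notation V := ('rV[R]_#|{: nonroot T}|).
Local Notation I := ('I_#|{: nonroot T}|).
Local Notation root := (Defs.root T).
Local Notation coord := (@Defs.coord R T).
Implicit Types (t : {perm T}) (a b c : T) (x y : V) (j : I) (mu : T -> R).

Definition vtx j : T := val (enum_val j).

Lemma vtx_nonroot j : vtx j != root.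
Proof. exact: valP (enum_val j). Qed.

Lemma vtx_inj : injective vtx.
Proof. by move=> i j /val_inj/enum_val_inj. Qed.

Lemma vtx_surj a : a != root -> exists j, vtx j = a.
Proof.
by move=> a0; exists (enum_rank (Sub a a0 : nonroot T)); rewrite /vtx enum_rankK SubK.
Qed.

Lemma coord_vtx x j : coord x (vtx j) = x 0 j.
Proof. by rewrite /Defs.coord /vtx valK enum_valK. Qed.

Lemma coordP x y : (forall a, a != root -> coord x a = coord y a) -> x = y.
Proof. by move=> xy; apply/rowP => j; rewrite -!coord_vtx xy ?vtx_nonroot. Qed.

Lemma coord_zero a : coord 0 a = 0.
Proof. by rewrite /Defs.coord; case: insub => [?|//]; rewrite mxE. Qed.

Definition coord_at a x : R := coord x a.

Lemma coord_at_is_linear a : linear (coord_at a).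
Proof.
move=> k x y; rewrite /coord_at /Defs.coord.
by case: insub => [?|]; rewrite ?mxE ?scaler0 ?addr0.
Qed.

HB.instance Definition _ a :=
  GRing.isLinear.Build R V R _ (coord_at a) (@coord_at_is_linear a).

(** Weights are read at the target: component [t a] of the image is [mu (t a)] times coordinate
    [a]. *)
Definition symm t mu x : V := \row_j (mu (vtx j) * coord x (t^-1%g (vtx j))).

Lemma symm_is_linear t mu : linear (symm t mu).
Proof.
move=> k x y; apply/rowP => j; rewrite !mxE -!/(coord_at _ _) coord_at_is_linear.
by rewrite mulrDr /= /GRing.scale /= mulrCA.
Qed.

HB.instance Definition _ t mu :=
  GRing.isLinear.Build R V V _ (symm t mu) (@symm_is_linear t mu).

(* Makes both terms of [x_p - eps x_a ^ 2] scale alike. *)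
Definition balanced mu : Prop :=
  (forall a, a != root -> 0 < mu a) /\
  forall a p c d q, root_path a = p ++ c :: d :: q -> mu c = mu d ^+ 2.

Section OneSymmetry.
Variables (t : {perm T}) (mu : T -> R).
Hypotheses (tP : tree_aut t) (muP : balanced mu).

Lemma coord_symm x a : a != root -> coord (symm t mu x) (t a) = mu (t a) * coord x a.
Proof.
rewrite -(nonroot_aut tP) => /vtx_surj[j jE].
by rewrite -jE coord_vtx mxE jE permK.
Qed.

Lemma root_path_split_nonroot a p c q : root_path a = p ++ c :: q -> c != root.
Proof. by move=> E; apply: (@root_path_nonroot T c a); rewrite E mem_cat mem_head orbT. Qed.

Lemma edge_sign_aut a p c d q : root_path a = p ++ c :: d :: q ->
  edge_sign R (t c) (t d) = edge_sign R c d.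
Proof.
move=> E; have [_ _ tneg] := tP; rewrite /edge_sign tneg //.
- exact: root_path_edge E.
- exact: root_path_split_nonroot E.
- by apply: (@root_path_split_nonroot a (rcons p c) d q); rewrite cat_rcons.
Qed.

(** Along an edge [c,d] of the chain, x_c is multiplied by [mu (t c)] and the square by
    [mu (t d) ^+ 2]; [balanced] makes the two factors equal. *)
Lemma phi_symm a p q x : root_path a = p ++ q ->
  phi (map t q) (symm t mu x) = mu (t (head root q)) * phi q x.
Proof.
elim: q p => [|c q IH] p E /=; first by rewrite mulr0.
rewrite coord_symm ?(root_path_split_nonroot E) // mulrBr; congr (_ - _).
rewrite (IH (rcons p c)) ?cat_rcons //.
case: q {IH} E => [|d q] E /=; first by rewrite !(expr0n, mulr0).
rewrite (edge_sign_aut E).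
have -> : mu (t c) = mu (t d) ^+ 2.
  by apply: (muP.2 (t a) (map t p) (t c) (t d) (map t q)); rewrite root_path_aut // E map_cat.
ring.
Qed.

Lemma corner_symm a p q x : root_path a = p ++ q ->
  corner (map t q) (symm t mu x) = corner q x.
Proof.
elim: q p => [|c q IH] p E //=.
have E' : root_path a = rcons p c ++ q by rewrite cat_rcons.
rewrite (IH _ E') (phi_symm _ E'); congr (_ && _).
case: q {IH E'} E => [|d q] E /=; first by rewrite !mulr0.
rewrite (edge_sign_aut E) mulrCA pmulr_rle0 //; apply: muP.1.
by rewrite nonroot_aut // (@root_path_split_nonroot a (rcons p c) d q) ?cat_rcons.
Qed.

Lemma on_piece_symm a x : on_piece (t a) (symm t mu x) = on_piece a x.
Proof.
rewrite /on_piece root_path_aut // (@corner_symm a [::]) // (@phi_symm a [::]) //.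
have [->|a0] := eqVneq a root; first by rewrite root_path_root /= mulr0.
congr (_ && _); rewrite mulf_eq0; suff /gt_eqF-> : 0 < mu (t (head root (root_path a))) by [].
apply: muP.1; rewrite nonroot_aut //; have := root_path_self a0.
case E : (root_path a) => [//|c q] _ /=.
exact: (@root_path_split_nonroot a [::] c q).
Qed.

End OneSymmetry.

Lemma phi_differentiable s x : differentiable (@phi R T s) x.
Proof.
elim: s => [|a s IH]; first exact: differentiable_cst.
have -> : phi (a :: s) = coord_at a - edge_sign R a (head a s) *: (phi s ^+ 2) :> (V -> R).
  by apply/funext.
apply: differentiableB; first exact: linear_rV_differentiable.
by apply: differentiableZ; exact: differentiableX.
Qed.

Section Coorientation.
Variables (t : {perm T}) (mu : T -> R).
Hypotheses (tP : tree_aut t) (muP : balanced mu).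

(** The defining function of a piece is carried to a positive multiple of that of its image, so
    positive half spaces correspond. The inverse map is assumed in the form of a symmetry, so that
    the lemma can be applied to it again for the converse in [coorientation_symm]. *)
Lemma coorientation_symm_sub x (P : set V) :
  cancel (symm t mu) (symm t^-1 (fun a => (mu (t a))^-1)) ->
  cancel (symm t^-1 (fun a => (mu (t a))^-1)) (symm t mu) ->
  coorientation x P -> coorientation (symm t mu x) (symm t mu @` P).
Proof.
move=> K1 K2 /coorientationE[a [a0 ax ->]]; apply/coorientationE.
exists (t a); rewrite nonroot_aut // on_piece_symm //; split=> //.
have mu0 : 0 < mu (t (head root (root_path a))).
  apply: muP.1; rewrite nonroot_aut //; have := root_path_self a0.
  case E : (root_path a) => [//|c q] _ /=.
  exact: (@root_path_split_nonroot a [::] c q).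
have key v : 'D_(symm t mu v) (phi (root_path (t a))) (symm t mu x) =
    mu (t (head root (root_path a))) * 'D_v (phi (root_path a)) x.
  rewrite -derive_comp_linear /=.
  have -> : phi (root_path (t a)) \o symm t mu =
      (mu (t (head root (root_path a))) *: phi (root_path a) : V -> R).
    by apply/funext => y /=; rewrite root_path_aut // (@phi_symm t mu tP muP a [::]).
  by rewrite deriveZ //; exact/diff_derivable/phi_differentiable.
apply/seteqP; split=> [_ [v /= v0 <-]|w /= w0]; first by rewrite key mulr_gt0.
exists (symm t^-1 (fun a => (mu (t a))^-1) w); last by rewrite K2.
by move: w0; rewrite -{1}[w]K2 key pmulr_rgt0.
Qed.

End Coorientation.

Section Inverse.
Variables (t : {perm T}) (mu : T -> R).
Hypotheses (tP : tree_aut t) (muP : balanced mu).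

Definition inv_weight a := (mu (t a))^-1.

Lemma inv_weight_balanced : balanced inv_weight.
Proof.
split=> [a a0|a p c d q E]; first by rewrite invr_gt0 muP.1 ?nonroot_aut.
rewrite /inv_weight exprVn; congr (_^-1).
by apply: (muP.2 (t a) (map t p) (t c) (t d) (map t q)); rewrite root_path_aut // E map_cat.
Qed.

Lemma symmK : cancel (symm t mu) (symm t^-1 inv_weight).
Proof.
move=> x; apply/coordP => a a0.
rewrite -{1}(permK t a) coord_symm ?nonroot_aut //; last exact: tree_aut_inv.
rewrite permK coord_symm // /inv_weight mulrA mulVf ?mul1r //.
by rewrite gt_eqF // muP.1 // nonroot_aut.
Qed.

Lemma symmVK : cancel (symm t^-1 inv_weight) (symm t mu).
Proof.
move=> x; apply/coordP => a a0.
have a0' : t^-1%g a != root by rewrite (nonroot_aut (tree_aut_inv tP)).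
rewrite -{1}(permKV t a) coord_symm // permKV coord_symm //; last exact: tree_aut_inv.
rewrite /inv_weight permKV mulrA divff ?mul1r //.
by rewrite gt_eqF // muP.1.
Qed.

End Inverse.

Lemma symm_inv_inv t mu : inv_weight t^-1 (inv_weight t mu) = mu.
Proof. by apply/funext => a; rewrite /inv_weight permKV invrK. Qed.

Lemma coorientation_symm t mu x P : tree_aut t -> balanced mu ->
  coorientation x P <-> coorientation (symm t mu x) (symm t mu @` P).
Proof.
move=> tP muP; have K1 := symmK tP muP; have K2 := symmVK tP muP.
split; first exact: coorientation_symm_sub.
have := @coorientation_symm_sub t^-1%g _ (tree_aut_inv tP) (inv_weight_balanced tP muP)
  (symm t mu x) (symm t mu @` P).
rewrite -/(inv_weight t^-1 (inv_weight t mu)) symm_inv_inv invgK => /(_ K2 K1) + H.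
move=> /(_ H); rewrite K1; congr coorientation.
apply/seteqP; split=> [_ [_ [v Pv <-] <-]|v Pv]; first by rewrite K1.
by exists (symm t mu v); [exists v | rewrite K1].
Qed.

Lemma front_symm t mu x : tree_aut t -> balanced mu ->
  front x <-> front (symm t mu x).
Proof.
move=> tP muP; split=> /frontE[a a0 ax]; apply/frontE.
  by exists (t a); rewrite ?nonroot_aut ?on_piece_symm.
exists (t^-1%g a); first by rewrite (nonroot_aut (tree_aut_inv tP)).
by rewrite -(on_piece_symm tP muP) permKV.
Qed.

End Symmetries.


(** * Iterated derivatives *)

Lemma differentiable_near_eq (R : realType) (V W : normedModType R) (f g : V -> W) (x : V) :
  {near x, f =1 g} -> differentiable f x -> differentiable g x.
Proof.
move=> fg /diff_locallyP[dfc dfE].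
have gE : g \o shift x = cst (g x) + 'd f x +o_ 0 id.
  move/eqaddoP : dfE => dfE; apply/eqaddoP => e e0.
  have fg0 := nbhs_singleton fg.
  have {}fg : \forall h \near 0, f (h + x) = g (h + x).
    have := fg; rewrite (near_shift 0) /=.
    by apply: filterS => h /=; rewrite subr0.
  apply: filterS2 fg (dfE e e0) => h fgh.
  by rewrite !fctE /= fgh fg0.
have dE := diff_unique dfc gE.
by apply/diff_locallyP; rewrite dE.
Qed.

Section IteratedDerivatives.
Variables (R : realType) (n : nat).
Local Notation V := ('rV[R]_n).
Implicit Types (f g : V -> V) (U : set V) (x y v : V) (vs : seq V).

Lemma derive_linear_comp (A : {linear V -> V}) g x v : differentiable g x ->
  'D_v (A \o g) x = A ('D_v g x).
Proof.
move=> dg; have := @diff_derivable _ _ _ _ _ v dg.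
rewrite /derivable /derive; set q := fun _ : R => _ => cq.
set q' := fun _ : R => _; have -> : q' = A \o q.
  by apply/funext => h; rewrite /q /q' /= -[in LHS]linearB -[in LHS]linearZ.
apply: cvg_lim => //; apply: cvg_comp; first exact: cq.
exact: linear_rV_continuous.
Qed.

(** Formula and differentiability are proved in one induction: differentiating the formula once more
    requires it on a neighbourhood, and differentiability of the next derivative is read off from
    it. *)
Lemma iter_derive_linear (A B : {linear V -> V}) f U vs :
  open U -> smooth_on U f -> forall x, U (B x) ->
  iter_derive vs (A \o f \o B) x = A (iter_derive (map B vs) f (B x)) /\
  differentiable (iter_derive vs (A \o f \o B)) x.
Proof.
move=> Uo fU; have BU : open (B @^-1` U).
  by apply: open_comp => // x _; exact: linear_rV_continuous.
have dAB g x : differentiable g (B x) -> differentiable (A \o g \o B) x.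
  move=> dg; apply: differentiable_comp; first exact: linear_rV_differentiable.
  by apply: differentiable_comp => //; exact: linear_rV_differentiable.
elim: vs => [|v vs IH] x Ux /=; first by split=> //; apply/dAB/(fU [::]).
have nE y : (B @^-1` U) y ->
    {near y, iter_derive vs (A \o f \o B) =1 A \o iter_derive (map B vs) f \o B}.
  move=> Uy; have := open_nbhs_nbhs (conj BU Uy); apply: filterS => z Uz.
  by have [-> _] := IH z Uz.
have DE y : (B @^-1` U) y -> 'D_v (iter_derive vs (A \o f \o B)) y =
    A ('D_(B v) (iter_derive (map B vs) f) (B y)).
  move=> Uy; rewrite (near_eq_derive _ (nE y Uy)) derive_comp_linear.
  by apply: derive_linear_comp; exact: fU.
split; first exact: DE.
apply: (@differentiable_near_eq _ _ _ (A \o iter_derive (map B (v :: vs)) f \o B)).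
  have := open_nbhs_nbhs (conj BU Ux); apply: filterS => z Uz.
  by rewrite /= DE.
by apply: dAB; exact: (fU (map B (v :: vs))).
Qed.

Lemma smooth_on_linear (A B : {linear V -> V}) f U :
  open U -> smooth_on U f -> smooth_on (B @^-1` U) (A \o f \o B).
Proof. by move=> Uo fU vs x Ux; have [] := iter_derive_linear A vs Uo fU Ux. Qed.

Lemma linear_smooth (A : {linear V -> V}) : smooth_on setT A.
Proof.
move=> vs x _; suff : iter_derive vs A = A \/ exists v, iter_derive vs A = cst v.
  by case=> [->|[v ->]]; [exact: linear_rV_differentiable | exact: differentiable_cst].
elim: vs => [|v vs IH]; [by left | right].
case: IH => [AE|[w wE]]; [exists (A v) | exists 0]; apply/funext => y /=.
  by rewrite AE -[A : V -> V]/(id \o A) derive_comp_linear derive_id.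
by rewrite wE derive_cst.
Qed.

Local Notation "''e_' i" := (delta_mx 0 i : V) (at level 8, i at level 2, format "''e_' i").

Definition partial (B : seq 'I_n) f : V -> V := iter_derive [seq 'e_i | i <- B] f.

Lemma derive_partial (W : normedModType R) (g : V -> W) x v : differentiable g x ->
  'D_v g x = \sum_i v 0 i *: 'D_'e_i g x.
Proof.
move=> dg; rewrite deriveE // {1}[v]row_sum_delta linear_sum.
by apply: eq_bigr => i _; rewrite linearZ deriveE.
Qed.

(* The terms of the expansion of [iter_derive vs] in iterated partial         *)
(* derivatives; no symmetry of second derivatives is involved.                *)
Fixpoint expansion vs : seq (R * seq 'I_n) :=
  if vs is v :: vs' then
    [seq (v 0 i * cB.1, i :: cB.2) | cB <- expansion vs', i <- enum 'I_n]
  else [:: (1, [::])].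

Lemma iter_derive_expansion f U vs x : open U -> smooth_on U f -> U x ->
  iter_derive vs f x = \sum_(cB <- expansion vs) cB.1 *: partial cB.2 f x.
Proof.
move=> Uo fU; elim: vs x => [|v vs IH] x Ux /=; first by rewrite big_seq1 scale1r.
have E : {near x, iter_derive vs f =1
    \sum_(cB <- expansion vs) (cB.1 *: partial cB.2 f : V -> V)}.
  have := open_nbhs_nbhs (conj Uo Ux); apply: filterS => z Uz.
  by rewrite IH // fct_sumE.
rewrite (near_eq_derive _ E) big_allpairs_dep /=.
have dB B : differentiable (partial B f) x by exact: fU.
have dS s : differentiable (\sum_(cB <- s) (cB.1 *: partial cB.2 f : V -> V)) x.
  elim: s => [|cB s IHs]; first by rewrite big_nil; exact: differentiable_cst.
  by rewrite big_cons; apply: differentiableD => //; exact: differentiableZ.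
elim: (expansion vs) => [|cB s IHs]; first by rewrite !big_nil derive_cst.
rewrite !big_cons deriveD; try exact: diff_derivable.
  rewrite IHs; congr (_ + _); rewrite deriveZ; last exact: diff_derivable.
  rewrite derive_partial // scaler_sumr big_enum; apply: eq_bigr => i _.
  by rewrite scalerA mulrC.
by apply: diff_derivable; exact: differentiableZ.
Qed.

Lemma smooth_on_subset f U U' : U' `<=` U -> smooth_on U f -> smooth_on U' f.
Proof. by move=> sU fU vs x /sU; exact: fU. Qed.

Lemma coord_derive g x v j : differentiable g x ->
  'D_v g x 0 j = 'D_v (fun y => g y 0 j) x.
Proof. by move=> dg; rewrite derive_mx ?mxE //; exact: diff_derivable. Qed.

Lemma derive_scale g x v (c : R) : differentiable g x -> 'D_(c *: v) g x = c *: 'D_v g x.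
Proof. by move=> dg; rewrite !deriveE // linearZ. Qed.

Lemma iter_derive_scale (c : 'I_n -> R) f U B x : open U -> smooth_on U f -> U x ->
  iter_derive [seq c i *: 'e_i | i <- B] f x = (\prod_(i <- B) c i) *: partial B f x.
Proof.
move=> Uo fU; elim: B x => [|i B IH] x Ux /=; first by rewrite big_nil scale1r.
have E : {near x, iter_derive [seq c i *: 'e_i | i <- B] f =1
    ((\prod_(i <- B) c i) *: partial B f : V -> V)}.
  by have := open_nbhs_nbhs (conj Uo Ux); apply: filterS => z Uz; rewrite IH.
have dB : differentiable (partial B f) x by exact: fU.
rewrite (near_eq_derive _ E) derive_scale; last exact: differentiableZ.
by rewrite deriveZ ?big_cons ?scalerA //; exact: diff_derivable.
Qed.

(** Directions outside [A] are tangent to the subspace where the [A]-coordinates vanish. The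
    induction keeps the vanishing at all points of the subspace near 0, so that it can be
    differentiated again. *)
Lemma partial_eq0 (A : pred 'I_n) (j : 'I_n) f U :
  open U -> smooth_on U f -> U 0 ->
  (\forall x \near (0 : V), (forall i, A i -> (x : V) 0 i = 0) -> f x 0 j = 0) ->
  forall B, all (predC A) B -> partial B f 0 0 j = 0.
Proof.
move=> Uo fU U0 f0 B AB.
suff : \forall x \near (0 : V),
    (forall i, A i -> (x : V) 0 i = 0) -> partial B f x 0 j = 0.
  by move=> /nbhs_singleton; apply=> i _; rewrite mxE.
elim: B AB => [//|i B IH] /= /andP[Ai /IH{}IH].
have := open_nbhs_nbhs (conj Uo U0); apply: filterS2 (nbhs_interior IH) => x xB Ux x0.
rewrite /= coord_derive; last exact: (fU [seq 'e_i | i <- B]).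
rewrite /derive; apply: norm_lim_near_cst.
have hx : (fun h : R => h *: 'e_i + x) @ 0^' --> x.
  rewrite -[X in _ --> X]add0r -(scale0r 'e_i); apply: cvgD; last exact: cvg_cst.
  by apply: cvgZr_tmp; apply: cvg_within_filter; exact: cvg_id.
have hB : \forall h \near (0 : R)^', (forall k, A k -> (h *: 'e_i + x) 0 k = 0) ->
  partial B f (h *: 'e_i + x) 0 j = 0 := hx _ xB.
near=> h; have hxB := near hB h; rewrite /=.
rewrite [X in X - _]hxB ?[X in _ - X](nbhs_singleton xB) ?subrr ?scaler0 //.
move=> k Ak; rewrite !mxE x0 // addr0 /= [k == i]negbTE ?mulr0 //.
by apply: contraTneq Ak => ->.
Unshelve. all: by end_near. Qed.

Lemma mean_value_coord g (rho : R) y j :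
  (forall z : V, `|z| < rho -> differentiable g z) -> `|y| < rho ->
  exists2 s : R, 0 < s < 1 &
    g y 0 j - g 0 0 j = \sum_i y 0 i * ('D_'e_i g (s *: y)) 0 j.
Proof.
move=> dg yr; pose u (s : R) : R := g (s *: y) 0 j.
have sy (s : R) : 0 <= s <= 1 -> `|s *: y| < rho.
  move=> /andP[s0 s1]; rewrite normrZ ger0_norm //.
  by apply: le_lt_trans yr; rewrite ler_piMl.
have du (s : R) : 0 <= s <= 1 -> differentiable u s.
  move=> s01; apply: (@differentiable_comp _ _ _ _ (fun s : R => g (s *: y)) (fun z : V => z 0 j)).
    by apply: differentiable_comp => //; exact/dg/sy.
  exact: differentiable_coord.
have [||s s01] := @MVT R u (fun s => 'D_y g (s *: y) 0 j) 0 1 ltr01.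
- move=> s; rewrite in_itv /= => /andP[s0 s1].
  have s01 : 0 <= s <= 1 by rewrite !ltW.
  apply: DeriveDef; first exact/diff_derivable/du.
  rewrite coord_derive; last exact/dg/sy.
  rewrite /derive; set q := fun _ : R => _; set q' := fun _ : R => _.
  suff -> : q = q' by [].
  by apply/funext => h; rewrite /q /q' /u /= [h%:A]mulr1 scalerDl.
- apply: continuous_in_subspaceT => s; rewrite inE /= in_itv /= => s01.
  exact/differentiable_continuous/du.
rewrite /u subr0 mulr1 scale1r scale0r => ->; exists s.
  by move: s01; rewrite in_itv.
rewrite derive_partial; last first.
  by apply/dg/sy; move: s01; rewrite in_itv /= => /andP[/ltW-> /ltW->].
by rewrite summxE; apply: eq_bigr => i _; rewrite mxE.
Qed.

End IteratedDerivatives.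


(** * Weighted dilation of smooth germs *)

Section Dilation.
Variables (R : realType) (n : nat) (w : 'I_n -> nat).
Hypothesis w_gt0 : forall i, (0 < w i)%N.
Local Notation V := ('rV[R]_n).
Implicit Types (x y : V) (r : R) (B : seq 'I_n).

Lemma rV_norm_le x (c : R) : 0 <= c -> (forall i, `|x 0 i| <= c) -> `|x| <= c.
Proof.
move=> c0 xc; rewrite [leLHS]/Num.Def.normr/= mx_normrE (bigmax_le _ c0) //= => -[i j] _ /=.
by rewrite ord1.
Qed.

Lemma rV_coord_norm_le x i : `|x 0 i| <= `|x|.
Proof.
rewrite [leRHS]/Num.Def.normr/= mx_normrE.
exact: (@le_bigmax _ _ _ 0 (fun ij : 'I_1 * 'I_n => `|x ij.1 ij.2|) (0, i)).
Qed.

Definition dil r x : V := \row_i (r ^+ w i * x 0 i).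

Lemma norm_dil r x : 0 <= r <= 1 -> `|dil r x| <= r * `|x|.
Proof.
move=> /andP[r0 r1]; apply: rV_norm_le => [|i]; first by rewrite mulr_ge0.
rewrite mxE normrM ler_pM ?normr_ge0 ?rV_coord_norm_le //.
rewrite normrX ger0_norm // -[leRHS]expr1 ler_wiXn2l //.
Qed.

Lemma dilZ r s x : s *: dil r x = dil r (s *: x).
Proof. by apply/rowP => i; rewrite !mxE mulrCA. Qed.

Definition wt B := (\sum_(i <- B) w i)%N.

Lemma wt_cons i B : wt (i :: B) = (w i + wt B)%N.
Proof. by rewrite /wt big_cons. Qed.

Section UniformScaling.
Variables (Z : Type) (S : set Z) (F : Z -> V -> V) (i0 j0 : 'I_n) (rho : R).
Hypothesis rho1 : rho <= 1.
Local Notation g B z y := (partial B (F z) y 0 j0).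
Hypothesis dF : forall z B x, S z -> `|x| < rho -> differentiable (partial B (F z)) x.
Hypothesis gcont : forall B (e : R), 0 < e ->
  exists2 d : R, 0 < d & forall z y, S z -> `|y| < d -> `|g B z y - g B z 0| <= e.
Hypothesis gbound : forall B, exists C : R, forall z, S z -> `|g B z 0| <= C.
Hypothesis g0 : forall z B, S z -> (wt B <= w i0)%N -> B != [:: i0] -> g B z 0 = 0.

(** The partial derivative [B] of the expected limit x |-> c x_i0, where c is [g [:: i0] z 0]. *)
Definition scaling_limit B z x : R :=
  if B is [::] then x 0 i0 * g [:: i0] z 0
  else if B == [:: i0] then g [:: i0] z 0 else 0.

(* Downward induction on the weight of [B]: above [w i0] the scaling factor   *)
(* tends to 0; below it, the mean value theorem along the segment from 0 to   *)
(* [dil r x] passes to the multi-indices [i :: B].                            *)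
Lemma uniform_scaling B (e : R) : 0 < e ->
  \forall r \near (0 : R)^'+, forall z x, S z -> `|x| < rho ->
    `|r ^+ wt B / r ^+ w i0 * g B z (dil r x) - scaling_limit B z x| <= e.
Proof.
have dil_lt r x d : 0 < r -> r <= 1 -> r < d -> `|x| < rho -> `|dil r x| < d.
  move=> r0 r1 rd xr; apply: le_lt_trans rd; apply: le_trans (norm_dil _ _) _.
    by rewrite ltW.
  by rewrite ler_piMr ?(ltW r0) // (le_trans (ltW xr)).
move: {2}((w i0).+1 - wt B)%N (leqnn ((w i0).+1 - wt B)%N) => k.
elim: k B e => [|k IH] B e.
  rewrite leqn0 subn_eq0 => wB e0.
  have [C CP] := gbound B; have [d d0 dP] := gcont B ltr01.
  have -> : scaling_limit B = fun _ _ => 0.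
    apply/funext => z; apply/funext => x; rewrite /scaling_limit.
    case: B wB {CP dP} => [|i B]; first by rewrite /wt big_nil.
    by case: eqP => // -> ; rewrite /wt big_seq1 ltnn.
  have C0 : 0 < `|C| + 1 by rewrite ltr_pwDr.
  near=> r => z x Sz xr.
  have r0 : 0 < r by near: r; exact: nbhs_right_gt.
  have r1 : r <= 1 by near: r; exact: nbhs_right_le.
  have rd : r < d by near: r; exact: nbhs_right_lt.
    rewrite subr0 -expfB // normrM normrX ger0_norm ?(ltW r0) //.
  have gC : `|g B z (dil r x)| <= `|C| + 1.
    rewrite -[X in `|X|](subrK (g B z 0)) addrC; apply: le_trans (ler_normD _ _) _.
    by rewrite lerD ?(le_trans (CP z Sz)) ?ler_norm // dP // dil_lt.
  apply: (@le_trans _ _ (r * (`|C| + 1))).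
    apply: ler_pM => //; first by rewrite exprn_ge0 ?ltW.
    by rewrite -[leRHS]expr1 ler_wiXn2l ?(ltW r0) // subn_gt0.
  rewrite -ler_pdivlMr //; near: r; apply: nbhs_right_le.
  by rewrite divr_gt0.
move=> wk e0; have [wB|wB] := ltnP (w i0) (wt B).
  by apply: IH => //; move: wB; rewrite -subn_eq0 => /eqP->.
have [->|Bi] := eqVneq B [:: i0].
  have [d d0 dP] := gcont [:: i0] e0.
  near=> r => z x Sz xr.
  have r0 : 0 < r by near: r; exact: nbhs_right_gt.
  have r1 : r <= 1 by near: r; exact: nbhs_right_le.
  have rd : r < d by near: r; exact: nbhs_right_lt.
  rewrite /wt big_seq1 divff ?mul1r /scaling_limit ?eqxx.
    by apply: dP => //; exact: dil_lt.
  by rewrite expf_neq0 // gt_eqF.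
(* The limits for the longer multi-indices recombine to the one for [B]; they are constant in the
   point, so the intermediate point of the mean value theorem drops out. *)
have limE z x s : \sum_i x 0 i * scaling_limit (i :: B) z (s *: x) = scaling_limit B z x.
  rewrite /scaling_limit; case: B Bi {wk wB} => [_|b B Bi].
    rewrite (bigD1 i0) //= eqxx big1 ?addr0 // => i ii0.
    by rewrite eqseq_cons andbT (negPf ii0) mulr0.
  rewrite (negPf Bi) big1 // => i _.
  by rewrite eqseq_cons andbC /= mulr0.
have e1 : 0 < e / n.+1%:R by rewrite divr_gt0.
have IHi : \forall r \near (0 : R)^'+, forall i z x, S z -> `|x| < rho ->
    `|r ^+ wt (i :: B) / r ^+ w i0 * g (i :: B) z (dil r x) -
      scaling_limit (i :: B) z x| <= e / n.+1%:R.
  apply: filter_forall => i; apply: IH => //.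
  have wi := w_gt0 i; move: wk wB wi; rewrite wt_cons; clear.
  by move: (w i0) (wt B) (w i) => a b c; lia.
near=> r => z x Sz xr.
have r0 : 0 < r by near: r; exact: nbhs_right_gt.
have r1 : r <= 1 by near: r; exact: nbhs_right_le.
have IHr : forall i z x, S z -> `|x| < rho ->
    `|r ^+ wt (i :: B) / r ^+ w i0 * g (i :: B) z (dil r x) -
      scaling_limit (i :: B) z x| <= e / n.+1%:R by near: r; exact: IHi.
have dr : `|dil r x| < rho.
  apply: le_lt_trans xr; apply: le_trans (norm_dil _ _) _; first by rewrite ltW.
  by rewrite ler_piMl.
have [s /andP[s0 s1] sE] := mean_value_coord j0 (fun y => dF B (x := y) Sz) dr.
rewrite g0 // subr0 in sE; rewrite sE -(limE z x s) mulr_sumr -sumrB.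
have sx : `|s *: x| < rho.
  by rewrite normrZ gtr0_norm //; apply: le_lt_trans xr; rewrite ler_piMl // ltW.
apply: le_trans (ler_norm_sum _ _ _) _.
apply: (@le_trans _ _ (\sum_(i < n) (e / n.+1%:R))); last first.
  rewrite sumr_const card_ord -[leLHS]mulr_natr -mulrA ler_piMr ?(ltW e0) //.
  by rewrite mulrC ler_pdivrMr // mul1r ler_nat.
apply: ler_sum => i _.
(* The factor r^(w i) in coordinate [i] of [dil r x] raises the weight of [B] to that of [i :: B],
   and the intermediate point is the dilation of [s *: x]. *)
have -> : r ^+ wt B / r ^+ w i0 *
    (dil r x 0 i * ('D_(delta_mx 0 i) (partial B (F z)) (s *: dil r x)) 0 j0) -
    x 0 i * scaling_limit (i :: B) z (s *: x) =
    x 0 i * (r ^+ wt (i :: B) / r ^+ w i0 * g (i :: B) z (dil r (s *: x)) -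
      scaling_limit (i :: B) z (s *: x)).
  rewrite dilZ [dil r x 0 i]mxE wt_cons exprD /=; ring.
rewrite normrM -[leRHS]mul1r ler_pM // ?IHr //.
by apply: le_trans (rV_coord_norm_le x i) _; rewrite (le_trans (ltW xr)).
Unshelve. all: by end_near. Qed.

End UniformScaling.
End Dilation.


(** * Weights of vertices and leading coefficients *)

Section Fiber.
Variables (R : realType) (T : signed_rooted_tree).
Local Notation V := ('rV[R]_#|{: nonroot T}|).
Local Notation I := ('I_#|{: nonroot T}|).
Local Notation root := (Defs.root T).
Local Notation coord := (@Defs.coord R T).
Implicit Types (t : {perm T}) (a b c d : T) (x y v : V) (i j : I) (s p q : seq T).

Lemma phi_coord0 s x : (forall c, c \in s -> coord x c = 0) -> phi s x = 0 /\ corner s x.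
Proof.
elim: s => [//|c s IH] /= x0.
have [|-> ->] := IH; first by move=> d ds; apply: x0; rewrite inE ds orbT.
by rewrite x0 ?mem_head // expr0n !mulr0 subr0 lexx.
Qed.

Lemma phi_suffix p q x : (forall c, c \in p -> coord x c = 0) ->
  phi (p ++ q) x = 0 -> phi q x = 0.
Proof.
elim: p => [//|c p IH] /= x0; rewrite x0 ?mem_head // sub0r => /eqP.
rewrite oppr_eq0 mulf_eq0 => /orP[/eqP e0|].
  by have := edge_sign_sqr R c (head c (p ++ q)); rewrite e0 mul0r => /esym/eqP; rewrite oner_eq0.
rewrite sqrf_eq0 => /eqP; apply: IH => d dp; apply: x0.
by rewrite inE dp orbT.
Qed.

Lemma corner_suffix p q x : corner (p ++ q) x -> corner q x.
Proof. by elim: p => [//|c p IH] /= /andP[_]. Qed.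

(** Induction away from the root: once the coordinates before [c] vanish, the equation of the piece
    of [c] collapses to x_c = 0, a sign being nonzero. *)
Lemma on_pieces_coord0 p q a x : root_path a = p ++ q ->
  (forall b, b \in p -> on_piece b x) -> forall b, b \in p -> coord x b = 0.
Proof.
elim/last_ind: p q => [//|p c IH] q; rewrite cat_rcons => E xp.
have {}IH : forall b, b \in p -> coord x b = 0.
  by apply: (IH _ E) => b bp; apply: xp; rewrite mem_rcons inE bp orbT.
move=> b; rewrite mem_rcons inE => /predU1P[->|/IH//].
have /andP[/eqP cx _] := xp c (etrans (mem_rcons p c c) (mem_head c p)).
move: cx; have := @root_path_prefix _ a (rcons p c) q.
rewrite cat_rcons last_rcons => /(_ E) ->; rewrite -cats1 => /(phi_suffix IH) /=.
by rewrite expr0n mulr0 subr0.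
Qed.

(** Depth is less than [#|T|], so the subtraction is never truncated and the weight of a parent is
    exactly twice that of its child. *)
Definition weight a : nat := 2 ^ (#|T| - size (root_path a)).
Definition wgt (j : I) : nat := weight (vtx j).

Lemma size_root_path a : (size (root_path a) < #|T|)%N.
Proof.
by have /card_uniqP/= <- := root_path_uniq a; exact: max_card.
Qed.

Lemma wgt_gt0 j : (0 < wgt j)%N.
Proof. by rewrite expn_gt0. Qed.

Lemma weight_edge a p c d q : root_path a = p ++ c :: d :: q -> weight c = (2 * weight d)%N.
Proof.
move=> E.
have Ed : root_path d = rcons (rcons p c) d.
  by have := @root_path_prefix _ a (rcons (rcons p c) d) q; rewrite !cat_rcons last_rcons; apply.
have Ec : root_path c = rcons p c.
  by have := @root_path_prefix _ a (rcons p c) (d :: q); rewrite cat_rcons last_rcons; apply.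
have := size_root_path d; rewrite /weight Ec Ed !size_rcons => sz.
by rewrite -expnS -subSn ?subSS // ltnW.
Qed.

Lemma weight_le a b : a \in root_path b -> (weight b <= weight a)%N.
Proof.
case/root_path_mem => q E; rewrite leq_exp2l // leq_sub2l //.
by rewrite E size_cat leq_addr.
Qed.

Lemma weight_inj a b : a \in root_path b -> weight a = weight b -> a = b.
Proof.
case/root_path_mem => q E /eqP; rewrite eqn_exp2l // => /eqP wE.
have := size_root_path a; have := size_root_path b; move: wE.
case: q E => [|d q] E; rewrite E.
  by move: E; rewrite cats0 => E _ _ _; rewrite -(root_path_last a) -E root_path_last.
rewrite size_cat /=; move: (size _) (size q) #|T| => u u' u''; lia.
Qed.

Definition dilw (r : R) : T -> R := fun a => r ^+ weight a.

Lemma dilw_balanced r : 0 < r -> balanced (dilw r).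
Proof.
move=> r0; split=> [a _|a p c d q E]; first exact: exprn_gt0.
by rewrite /dilw (weight_edge E) mulnC exprM.
Qed.

Lemma tree_aut1 : tree_aut (1%g : {perm T}).
Proof. by split=> *; rewrite ?perm1. Qed.

Lemma dilE r x : dil wgt r x = symm 1%g (dilw r) x.
Proof. by apply/rowP => j; rewrite !mxE invg1 perm1 coord_vtx. Qed.

Definition unit_vec a : V := \row_j (vtx j == a)%:R.

Lemma unit_vec_vtx i : unit_vec (vtx i) = delta_mx 0 i.
Proof. by apply/rowP => j; rewrite !mxE (inj_eq (@vtx_inj T)) eqxx. Qed.

Lemma coord_unit_vec a b : b != root -> coord (unit_vec a) b = (b == a)%:R.
Proof. by case/vtx_surj => j <-; rewrite coord_vtx mxE. Qed.

(** The coefficient c_a of x_a in the component [b = t a] of the linear part at 0, indexed by the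
    target [b] like the weights of [symm]. *)
Definition lead t (f : V -> V) b : R := coord ('D_(unit_vec (t^-1%g b)) f 0) b.

Lemma lead_vtx t f i j : vtx j = t (vtx i) -> lead t f (vtx j) = partial [:: i] f 0 0 j.
Proof. by move=> jE; rewrite /lead coord_vtx {1}jE permK unit_vec_vtx. Qed.

End Fiber.


(** * Germs preserving the front *)

Section PiecePermutingGerms.
Variables (R : realType) (T : signed_rooted_tree).
Local Notation V := ('rV[R]_#|{: nonroot T}|).
Local Notation I := ('I_#|{: nonroot T}|).
Local Notation root := (Defs.root T).
Local Notation coord := (@Defs.coord R T).
Implicit Types (t : {perm T}) (f g : V -> V) (a b c d : T) (x y v : V)
  (i j : I) (U W : set V) (B : seq I).

Lemma permutes_on_piece t f : tree_aut t -> permutes_pieces f t ->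
  \forall x \near (0 : V), forall b, b != root -> on_piece b x <-> on_piece (t b) (f x).
Proof.
move=> tP ft;
apply: (@filter_forall _ _ (fun b (x : V) => b != root ->
  on_piece b x <-> on_piece (t b) (f x)) (nbhs (0 : V)) _) => b.
have [->|b0] := eqVneq b root; first by apply: nearW.
move: (ft b b0); apply: filterS => x fx _.
by rewrite -!smooth_pieceE // nonroot_aut.
Qed.

Lemma vanish_near t f a : tree_aut t -> permutes_pieces f t -> a != root ->
  \forall x \near (0 : V), (forall i, vtx i \in root_path a -> (x : V) 0 i = 0) ->
    coord (f x) (t a) = 0.
Proof.
move=> tP ft a0; move: (permutes_on_piece tP ft); apply: filterS => x fx x0.
have xa b : b \in root_path a -> on_piece b x.
  move=> ba; rewrite /on_piece; have [|-> ->] := @phi_coord0 R T (root_path b) x; last by rewrite eqxx.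
  move=> c cb; have ca := root_path_le cb ba; have [i iE] := vtx_surj (root_path_nonroot ca).
  by rewrite -iE coord_vtx x0 ?iE.
apply: (@on_pieces_coord0 R T (root_path (t a)) [::] (t a)).
- by rewrite cats0.
- move=> b; rewrite root_path_aut // => /mapP[c ca ->].
  by apply/fx; [exact: root_path_nonroot ca | exact: xa].
- by rewrite root_path_self ?nonroot_aut.
Qed.

(** If [B] contained an ancestor of [i0], that entry alone would weigh at least [wgt i0]; the bound
    then forces [B] to be [[:: i0]]. So [B] only differentiates along the subspace of
    [vanish_near]. *)
Lemma partial_vanish t f U i0 j0 B : tree_aut t -> permutes_pieces f t ->
  open U -> U 0 -> smooth_on U f -> vtx j0 = t (vtx i0) ->
  (wt (@wgt T) B <= wgt i0)%N -> B != [:: i0] -> partial B f 0 0 j0 = 0.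
Proof.
move=> tP ft Uo U0 fU j0E wB Bi0.
apply: (@partial_eq0 _ _ [pred i | vtx i \in root_path (vtx i0)] j0 f U) => //.
  move: (vanish_near tP ft (vtx_nonroot i0)); apply: filterS => x fx x0.
  by rewrite -coord_vtx j0E fx // => i /x0.
apply/allP => i iB; apply/negP => /= ii0; move/negP: Bi0; apply.
have wi := weight_le ii0.
have [s1 [s2 BE]] : exists s1 s2, B = s1 ++ i :: s2.
  by case/splitPr: iB => s1 s2; exists s1, s2.
move: wB; rewrite BE /wt big_cat big_cons /= => wB.
case: s1 s2 BE wB => [|k s1] [|l s2] BE; rewrite ?big_nil ?big_cons.
- rewrite addn0 add0n => wB; suff /vtx_inj-> : vtx i = vtx i0 by [].
  by apply: weight_inj ii0 _; apply/eqP; rewrite eqn_leq wB wi.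
- by have := wgt_gt0 l; rewrite /wgt in wi *; lia.
- by have := wgt_gt0 k; rewrite /wgt in wi *; lia.
- by have := wgt_gt0 l; rewrite /wgt in wi *; lia.
Qed.

Lemma derive_vanish t f U i j : tree_aut t -> permutes_pieces f t ->
  open U -> U 0 -> smooth_on U f -> vtx i \notin root_path (t^-1%g (vtx j)) ->
  partial [:: i] f 0 0 j = 0.
Proof.
move=> tP ft Uo U0 fU ij.
have [i0 i0E] : exists i0, vtx i0 = t^-1%g (vtx j).
  by apply: vtx_surj; rewrite (nonroot_aut (tree_aut_inv tP)) vtx_nonroot.
apply: (@partial_eq0 _ _ [pred i | vtx i \in root_path (vtx i0)] j f U) => //.
  move: (vanish_near tP ft (vtx_nonroot i0)); apply: filterS => x fx x0.
  by rewrite -coord_vtx -{1}(permKV t (vtx j)) -i0E fx // => k /x0.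
by rewrite /= i0E ij.
Qed.

Lemma permutes_pieces_inv t f g : tree_aut t -> permutes_pieces f t ->
  g @ (0 : V) --> (0 : V) -> germ_eq (f \o g) id -> permutes_pieces g t^-1%g.
Proof.
move=> tP ft g0 fg a a0.
have ta0 : t^-1%g a != root by rewrite (nonroot_aut (tree_aut_inv tP)).
have := g0 _ (ft _ ta0) => gf.
apply: filterS2 fg gf => y /= fgy.
by move=> gf; rewrite -[in X in X <-> _]fgy -{1}(permKV t a); exact: iff_sym.
Qed.

(** By [derive_vanish] for [f] and [g] the Jacobians are triangular for the tree order, up to [t].
    In the chain rule for g o f = id, the diagonal entry 1 at [a] is a single product with factor
    [lead t f (t a)]. *)
Lemma lead_neq0 t f g U W a : tree_aut t -> permutes_pieces f t ->
  permutes_pieces g t^-1%g ->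
  open U -> U 0 -> smooth_on U f -> open W -> W 0 -> smooth_on W g ->
  f 0 = 0 -> germ_eq (g \o f) id -> a != root -> lead t f (t a) != 0.
Proof.
move=> tP ft gt Uo U0 fU Wo W0 gW f0 gf a0.
have [i iE] := vtx_surj a0.
have [j jE] : exists j, vtx j = t a by apply: vtx_surj; rewrite nonroot_aut.
rewrite -jE (@lead_vtx R T t f i j) ?iE //; apply/eqP => c0.
have df : differentiable f 0 by exact: (fU [::]).
have dg : differentiable g (f 0) by rewrite f0; exact: (gW [::]).
have E : 'D_(delta_mx 0 i) (g \o f) 0 0 i = 1.
  rewrite (near_eq_derive _ gf) derive_id !mxE !eqxx //.
have : 'D_(delta_mx 0 i) (g \o f) 0 = \sum_k partial [:: i] f 0 0 k *: partial [:: k] g 0.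
  rewrite deriveE; last exact: differentiable_comp.
  rewrite (diff_comp df dg) /= f0 -deriveE; last by rewrite -f0.
  rewrite derive_partial; last by rewrite -f0.
  by rewrite -deriveE.
move=> /(congr1 (fun u : V => u 0 i)); rewrite E summxE big1; last first.
  move=> k _; rewrite mxE.
  have [ik|ik] := boolP (vtx i \in root_path (t^-1%g (vtx k))); last first.
    by rewrite (derive_vanish tP ft Uo U0 fU ik) mul0r.
  have [ki|ki] := boolP (vtx k \in root_path (t^-1^-1%g (vtx i))); last first.
    by rewrite (derive_vanish (tree_aut_inv tP) gt Wo W0 gW ki) mulr0.
  suff -> : k = j by rewrite c0 mul0r.
  have ik' : vtx i = t^-1%g (vtx k).
    apply: root_path_antisym => //.
    by move: ki; rewrite invgK root_path_aut // => /mapP[c ci ->]; rewrite permK.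
  by apply: vtx_inj; rewrite jE -iE ik' permKV.
by move=> /eqP; rewrite oner_eq0.
Qed.

End PiecePermutingGerms.


(** * Relations between leading coefficients along an edge *)

Section LeadingPart.
Variables (R : realType) (T : signed_rooted_tree).
Local Notation V := ('rV[R]_#|{: nonroot T}|).
Local Notation I := ('I_#|{: nonroot T}|).
Local Notation root := (Defs.root T).
Local Notation coord := (@Defs.coord R T).
Implicit Types (t : {perm T}) (f g : V -> V) (a b c d : T) (x y v : V) (i j : I)
  (U W : set V) (B : seq I) (p q s : seq T).

Lemma open_ball0 U : open U -> U 0 ->
  exists2 rho : R, 0 < rho <= 1 & forall x, `|x| < rho -> U x.
Proof.
move=> Uo U0; have /nbhs_normP[d /= d0 dU] := open_nbhs_nbhs (conj Uo U0).
exists (Num.min d 1); first by rewrite lt_min d0 ltr01 ge_min lexx orbT.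
move=> x; rewrite lt_min => /andP[xd _]; apply: dU.
by rewrite /= sub0r normrN.
Qed.

Lemma dil_near0 x (P : V -> Prop) : (\forall y \near (0 : V), P y) ->
  \forall r \near (0 : R)^'+, P (dil (@wgt T) r x).
Proof.
move=> /nbhs_normP[d /= d0 dP]; near=> r; apply: dP => /=; rewrite sub0r normrN.
have r0 : 0 < r by near: r; exact: nbhs_right_gt.
have r1 : r <= 1 by near: r; exact: nbhs_right_le.
apply: le_lt_trans (norm_dil (@wgt_gt0 T) _ _) _; first by rewrite ltW.
have : r < d / (`|x| + 1).
  by near: r; apply: nbhs_right_lt; rewrite divr_gt0 // ltr_wpDl.
rewrite ltr_pdivlMr ?ltr_wpDl //; apply: le_lt_trans.
by rewrite ler_wpM2l ?(ltW r0) // lerDl.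
Unshelve. all: by end_near. Qed.

(** The case of a single germ, a one-point parameter space and no derivatives in
    [uniform_scaling]. *)
Lemma germ_scaling t f U a : tree_aut t -> permutes_pieces f t ->
  open U -> U 0 -> smooth_on U f -> a != root ->
  exists2 rho : R, 0 < rho & forall x, `|x| < rho ->
    coord (f (dil (@wgt T) r x)) (t a) / r ^+ weight a @[r --> 0^'+] -->
      lead t f (t a) * coord x a.
Proof.
move=> tP ft Uo U0 fU a0.
have [i iE] := vtx_surj a0.
have [j jE] : exists j, vtx j = t a by apply: vtx_surj; rewrite nonroot_aut.
have [rho /andP[rho0 rho1] rhoU] := open_ball0 Uo U0.
exists rho => // x xr.
rewrite -jE (@lead_vtx R T t f i j) ?iE // -iE coord_vtx.
under eq_fun do rewrite coord_vtx.
apply/cvgrPdist_le => /= e e0.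
have gc B (e' : R) : 0 < e' -> exists2 d : R, 0 < d &
    forall (z : unit) y, setT z -> `|y| < d ->
      `|partial B f y 0 j - partial B f 0 0 j| <= e'.
  move=> e'0.
  have /differentiable_continuous cB : differentiable (partial B f) 0 by exact: fU.
  have /cvgrPdist_le/(_ _ e'0) := continuous_comp cB (@coord_continuous _ _ _ 0 j _).
  move=> /nbhs_normP[d /= d0 dP]; exists d => // _ y _ yd; rewrite distrC.
  by apply: dP => /=; rewrite sub0r normrN.
have := @uniform_scaling R _ (@wgt T) (@wgt_gt0 T) unit setT (fun _ => f) i j rho rho1
  _ gc _ _ [::] e e0.
case=> [z B y _ yr|B|z B _ wB Bi|]; first by apply: fU; exact: rhoU.
- by exists `|partial B f 0 0 j|.
- by apply: (partial_vanish tP ft Uo U0 fU _ wB Bi); rewrite iE.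
move=> d /= d0 dP; exists d => // r rd r0.
have := dP r rd r0 tt x Logic.I xr.
by rewrite /wt big_nil expr0 div1r mulrC distrC [x 0 i * _]mulrC.
Qed.

Lemma phi_cat0 p s x : (forall c, c \in p -> coord x c = 0) -> phi s x = 0 ->
  phi (p ++ s) x = 0 /\ corner (p ++ s) x = corner s x.
Proof.
elim: p => [//|c p IH] x0 sx /=.
have [|-> ->] := IH _ sx; first by move=> b bp; apply: x0; rewrite inE bp orbT.
by rewrite x0 ?mem_head // expr0n !mulr0 subr0 lexx.
Qed.

Lemma on_piece_dil a x r : 0 < r -> on_piece a (dil (@wgt T) r x) = on_piece a x.
Proof.
move=> r0; rewrite dilE -[in LHS](perm1 a).
by rewrite (on_piece_symm (tree_aut1 T) (dilw_balanced T r0)).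
Qed.

(** A point of the piece of [d] with zero coordinates before [c] is dilated and sent through [f].
    Its images satisfy the equation and inequality of the piece of [t d]; divided by the right
    powers of r, these pass to the limit as relations between the two coefficients. *)
Lemma lead_edge t f U b q c d s : tree_aut t -> permutes_pieces f t ->
  open U -> U 0 -> smooth_on U f -> root_path b = q ++ c :: d :: s ->
  lead t f (t c) = lead t f (t d) ^+ 2 /\ 0 <= lead t f (t d).
Proof.
move=> tP ft Uo U0 fU bE.
have cq : root_path c = rcons q c.
  by have := @root_path_prefix _ b (rcons q c) (d :: s); rewrite cat_rcons last_rcons; apply.
have dq : root_path d = q ++ [:: c; d].
  have := @root_path_prefix _ b (q ++ [:: c; d]) s.
  by rewrite -catA last_cat /=; apply.
have c0 : c != root by apply: (@root_path_nonroot _ c c); rewrite cq mem_rcons mem_head.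
have d0 : d != root by apply: (@root_path_nonroot _ d d); rewrite dq mem_cat !inE eqxx !orbT.
have := root_path_uniq d; rewrite dq /= cat_uniq /= !inE !orbF negb_or.
move=> /and4P[_ _ /andP[cnq dnq] /andP[cd _]].
pose sg := edge_sign R c d; have sg2 : sg * sg = 1 by exact: edge_sign_sqr.
have sgX : sg ^+ 2 = 1 by rewrite expr2.
have sgE : edge_sign R (t c) (t d) = sg by exact: edge_sign_aut bE.
have [rc rc0 limc] := germ_scaling tP ft Uo U0 fU c0.
have [rd rd0 limd] := germ_scaling tP ft Uo U0 fU d0.
(* Small enough for both scaling limits; u < 1 makes u^2 <= u, hence the norm of the test point at
   most u. *)
pose u := Num.min (Num.min rc rd) 1 / 2.
have m0 : 0 < Num.min (Num.min rc rd) 1 by rewrite !lt_min rc0 rd0 ltr01.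
have u0 : 0 < u by rewrite divr_gt0.
have um : u < Num.min (Num.min rc rd) 1 by rewrite ltr_pdivrMr // ltr_pMr // ltr1n.
move: um; rewrite !lt_min => /andP[/andP[urc urd] u1].
clearbody u.
(* Solves x_c = sg x_d^2 with sg x_d = -u <= 0: on the piece of [d], with x_c nonzero so that both
   coefficients can be read off. *)
pose x : V := (sg * u ^+ 2) *: unit_vec R c - (sg * u) *: unit_vec R d.
have xE b' : b' != root -> coord x b' =
    sg * u ^+ 2 * (b' == c)%:R - sg * u * (b' == d)%:R.
  by move=> b'0; rewrite -!coord_unit_vec // -/(coord_at b' x) linearB !linearZ.
have xc : coord x c = sg * u ^+ 2 by rewrite xE // eqxx (negPf cd) mulr0 subr0 mulr1.
have xd : coord x d = - (sg * u).
  by rewrite xE // eqxx eq_sym (negPf cd) mulr0 sub0r mulr1.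
have xq b' : b' \in q -> coord x b' = 0.
  move=> b'q; have b'0 : b' != root by apply: (@root_path_nonroot _ b' d); rewrite dq mem_cat b'q.
  have /negPf b'c : b' != c by apply: contraNneq cnq => <-.
  have /negPf b'd : b' != d by apply: contraNneq dnq => <-.
  by rewrite xE // b'c b'd !mulr0 subr0.
have sgn1 : `|sg| = 1 by rewrite /sg /edge_sign normrX normrN1 expr1n.
have xu : `|x| <= u.
  apply: rV_norm_le => [|i]; first exact: ltW.
  rewrite -coord_vtx; have [->|ic] := eqVneq (vtx i) c.
    rewrite xc normrM sgn1 mul1r normrX (gtr0_norm u0) expr2.
    by rewrite ler_piMr ?(ltW u0) ?(ltW u1).
  have [->|id] := eqVneq (vtx i) d.
    by rewrite xd normrN normrM sgn1 mul1r gtr0_norm.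
  by rewrite xE ?vtx_nonroot // (negPf ic) (negPf id) !mulr0 subr0 normr0 ltW.
have xpd : on_piece d x.
  have phi2 : phi [:: c; d] x = 0.
    rewrite /= xc xd expr0n mulr0 subr0 -/sg sqrrN exprMn sgX mul1r.
    by rewrite subrr.
  rewrite /on_piece dq; have [-> ->] := phi_cat0 xq phi2.
  rewrite eqxx /= xd expr0n !mulr0 subr0 -/sg lexx andbT mulrN mulrA sg2 mul1r.
  by rewrite oppr_le0 ltW.
have xpq b' : b' \in q -> on_piece b' x.
  move=> b'q; rewrite /on_piece.
  have [|-> ->] := @phi_coord0 R T (root_path b') x; last by rewrite eqxx.
  move=> e eb'; apply: xq.
  have b'c : b' \in root_path c by rewrite cq mem_rcons inE b'q orbT.
  have := root_path_le eb' b'c; rewrite cq mem_rcons inE => /predU1P[ec|//].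
  by move: b'q cnq; rewrite -(root_path_antisym b'c) -?ec // => ->.
have wcd : weight c = (2 * weight d)%N by exact: weight_edge bE.
have key : \forall r \near (0 : R)^'+,
    coord (f (dil (@wgt T) r x)) (t c) / r ^+ weight c =
      sg * (coord (f (dil (@wgt T) r x)) (t d) / r ^+ weight d) ^+ 2 /\
    sg * (coord (f (dil (@wgt T) r x)) (t d) / r ^+ weight d) <= 0.
  have near1 := dil_near0 x (permutes_on_piece tP ft).
  near=> r.
  have r0 : 0 < r by near: r; exact: nbhs_right_gt.
  have fr : forall b', b' != root ->
      on_piece b' (dil (@wgt T) r x) <-> on_piece (t b') (f (dil (@wgt T) r x)).
    by near: r; exact: near1.
  set y := f _ in fr *.
  have yd : on_piece (t d) y by apply/fr => //; rewrite on_piece_dil.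
  have ydE : root_path (t d) = map t q ++ [:: t c; t d].
    by rewrite root_path_aut // dq map_cat.
  have yq : forall b', b' \in map t q -> coord y b' = 0.
    apply: (on_pieces_coord0 ydE) => _ /mapP[b' b'q ->].
    have b'0 : b' != root by apply: (@root_path_nonroot _ b' d); rewrite dq mem_cat b'q.
    by apply/fr => //; rewrite on_piece_dil // xpq.
  move: yd; rewrite /on_piece ydE => /andP[/eqP/(phi_suffix yq) + /corner_suffix].
  rewrite /= sgE expr0n !mulr0 !subr0 => yphi /andP[ycor _].
  split.
    by rewrite (subr0_eq yphi) wcd mulnC exprM expr_div_n -mulrA.
  by rewrite mulrA pmulr_lle0 // invr_gt0 exprn_gt0.
have {}limc := limc x (le_lt_trans xu urc).
have {}limd := limd x (le_lt_trans xu urd).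
have sgd : sg * (coord (f (dil (@wgt T) r x)) (t d) / r ^+ weight d) @[r --> 0^'+]
    --> sg * (lead t f (t d) * coord x d).
  by apply: cvgM => //; exact: cvg_cst.
split.
  have lim2 : sg * (coord (f (dil (@wgt T) r x)) (t d) / r ^+ weight d) ^+ 2 @[r --> 0^'+]
      --> sg * (lead t f (t d) * coord x d) ^+ 2.
    by apply: cvgM; [exact: cvg_cst | exact: (cvgM limd limd)].
  have eqn : lead t f (t c) * coord x c = sg * (lead t f (t d) * coord x d) ^+ 2.
    apply: (norm_cvg_unique limc); apply: (cvg_trans _ lim2); apply: near_eq_cvg.
    by apply: (filterS _ key) => r [-> _].
  move: eqn; rewrite xc xd mulrN sqrrN !exprMn sgX mul1r.
  move=> eqn; apply: (@mulfI _ (sg * u ^+ 2)).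
    by rewrite mulf_neq0 ?expf_neq0 ?(gt_eqF u0) // -normr_eq0 sgn1 oner_eq0.
  rewrite mulrC eqn; ring.
have : sg * (lead t f (t d) * coord x d) <= 0.
  by apply: (@cvgr_to_le _ _ _ _ _ _ _ sgd); apply: (filterS _ key) => r [].
by rewrite xd !mulrN mulrCA [sg * (sg * u)]mulrA sg2 mul1r oppr_le0 pmulr_lge0.
Unshelve. all: by end_near. Qed.

End LeadingPart.


(** * Signs of the leading coefficients and composition with symmetries *)

Section FiberSymmetries.
Variables (R : realType) (T : signed_rooted_tree).
Local Notation V := ('rV[R]_#|{: nonroot T}|).
Local Notation I := ('I_#|{: nonroot T}|).
Local Notation root := (Defs.root T).
Local Notation coord := (@Defs.coord R T).
Implicit Types (t u : {perm T}) (f g : V -> V) (a b c d : T) (x y v : V) (i j : I)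
  (U W : set V) (B : seq I) (p q s : seq T) (mu nu : T -> R).

(** Squares have no linear part at 0, so every piece is tangent there to the hyperplane of the first
    vertex of its root path. *)
Lemma derive_phi0 s v : 'D_v (@phi R T s) 0 = coord v (head root s).
Proof.
case: s => [|c s].
  by rewrite /= /Defs.coord insubF ?eqxx //; exact: derive_cst.
have -> : phi (c :: s) = coord_at c - edge_sign R c (head c s) *: (phi s ^+ 2) :> (V -> R).
  by apply/funext.
have ds : derivable (@phi R T s) 0 v by apply: diff_derivable; exact: phi_differentiable.
have s0 : @phi R T s 0 = 0 by apply: (phi_coord0 _).1 => e _; rewrite coord_zero.
rewrite deriveB; last 2 first.
- by apply: diff_derivable; exact: linear_rV_differentiable.
- by apply: derivableZ; exact: derivableX.
rewrite deriveZ ?deriveX ?s0 ?expr1 ?mulr0 ?scale0r ?scaler0 ?subr0 //; last exact: derivableX.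
by rewrite -[coord_at c]/(id \o coord_at c) derive_comp_linear derive_id.
Qed.

(** The differential sends the half space v_a > 0 onto a half space w_e > 0, while (df v)_(t a) = c
    v_a. If e = t a, then c is the [e]-component of the image of a positive vector, hence positive;
    otherwise a contradiction arises. *)
Lemma lead_top t f U a : tree_aut t -> permutes_pieces f t -> preserves_front f ->
  f 0 = 0 -> open U -> U 0 -> smooth_on U f -> root_path a = [:: a] ->
  lead t f (t a) != 0 -> 0 < lead t f (t a).
Proof.
move=> tP ft ff f0 Uo U0 fU aE c0.
have a0 : a != root by apply: (@root_path_nonroot _ a a); rewrite aE mem_head.
have [i iE] := vtx_surj a0.
have [j jE] : exists j, vtx j = t a by apply: vtx_surj; rewrite nonroot_aut.
have df : differentiable f 0 by exact: (fU [::]).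
have dfE v : coord ('d f 0 v) (t a) = lead t f (t a) * coord v a.
  rewrite -deriveE // derive_partial // -jE coord_vtx summxE (bigD1 i) //= big1; last first.
    move=> k ki; rewrite mxE -[X in _ * X]/(partial [:: k] f 0 0 j).
    rewrite (derive_vanish tP ft Uo U0 fU) ?mulr0 // jE permK aE inE -iE.
    by rewrite (inj_eq (@vtx_inj T)).
  by rewrite addr0 mxE (@lead_vtx R T t f i j) ?iE // -iE coord_vtx mulrC.
have [_ /(_ [set v : V | 0 < coord v a]) coor] := nbhs_singleton ff.
have [|b [b0 _ PE]] := (coorientationE _ _).1 (coor.1 _).
  apply/coorientationE; exists a; split=> //.
    rewrite /on_piece; have [|-> ->] := @phi_coord0 R T (root_path a) 0.
      by move=> *; rewrite coord_zero.
    by rewrite eqxx.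
  by apply/seteqP; split=> v; rewrite /= derive_phi0 aE.
pose e := head root (root_path b).
have Pe w : (exists2 v : V, 0 < coord v a & 'd f 0 v = w) <-> 0 < coord w e.
  have := congr1 (fun S : set V => S w) PE; rewrite /= f0 derive_phi0 => <-.
  by split.
have u1 : coord ('d f 0 (unit_vec R a)) (t a) = lead t f (t a).
  by rewrite dfE coord_unit_vec // eqxx mulr1.
have ue : 0 < coord ('d f 0 (unit_vec R a)) e.
  by apply/Pe; exists (unit_vec R a) => //; rewrite coord_unit_vec // eqxx.
have [eE|neq] := eqVneq e (t a); first by rewrite -u1 -eE.
have e0 : e != root.
  rewrite /e; have := root_path_self b0.
  by case E : (root_path b) => [//|k s] _ /=; exact: (@root_path_split_nonroot _ b [::] k s).
(* When e <> t a, clearing the [t a]-component leaves a vector of the image half space; it is df v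
   with v_a > 0, yet c v_a = 0. *)
have [] : 0 < coord ('d f 0 (unit_vec R a) - lead t f (t a) *: unit_vec R (t a)) e.
  rewrite -/(coord_at _ _) linearB linearZ /= /coord_at.
  by rewrite [coord (unit_vec _ _) _]coord_unit_vec // (negPf neq) scaler0 subr0.
move/Pe => [v va] /(congr1 (coord_at (t a))).
rewrite linearB linearZ /= /coord_at dfE u1 coord_unit_vec ?nonroot_aut // eqxx.
rewrite /GRing.scale /= mulr1 subrr => /eqP; rewrite mulf_eq0 (negPf c0) /=.
by rewrite gt_eqF.
Qed.

Lemma lead_balanced t f : tree_aut t -> natural_map_fiber t f -> balanced (lead t f).
Proof.
move=> tP [[[f0 [U [Uo U0 fU]] [g [g0 [W [Wo W0 gW]] gf fg]]] ff] ft].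
have gcont : g @ (0 : V) --> (0 : V).
  rewrite -[X in _ --> X]g0; apply: differentiable_continuous; exact: (gW [::]).
have gt := permutes_pieces_inv tP ft gcont fg.
have c0 a : a != root -> lead t f (t a) != 0.
  exact: lead_neq0 tP ft gt Uo U0 fU Wo W0 gW f0 gf.
have tV b p c d s : root_path b = p ++ c :: d :: s ->
    root_path (t^-1%g b) = map t^-1%g p ++ t^-1%g c :: t^-1%g d :: map t^-1%g s.
  by move=> bE; rewrite (root_path_aut (tree_aut_inv tP)) bE map_cat.
split=> [b b0|b p c d s bE].
  have tb0 : t^-1%g b != root by rewrite (nonroot_aut (tree_aut_inv tP)).
  have [p pE _] := root_path_rcons tb0; rewrite -(permKV t b).
  case: (lastP p) pE => [|p' c] pE; first exact: lead_top tP ft ff f0 Uo U0 fU pE (c0 _ tb0).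
  have bE : root_path (t^-1%g b) = p' ++ c :: t^-1%g b :: [::] by rewrite pE -cats1 cat_rcons.
  by rewrite lt_neqAle eq_sym c0 //; have [] := lead_edge tP ft Uo U0 fU bE.
by have [] := lead_edge tP ft Uo U0 fU (tV _ _ _ _ _ bE); rewrite !permKV.
Qed.

Lemma near0_linear (A : {linear V -> V}) (P : V -> Prop) :
  (\forall y \near (0 : V), P y) -> \forall x \near (0 : V), P (A x).
Proof.
move=> P0; have := @linear_rV_continuous _ _ _ A 0.
by rewrite /continuous_at (linear0 A); apply.
Qed.

Lemma on_piece_symm1 mu a x : balanced mu -> on_piece a (symm 1%g mu x) = on_piece a x.
Proof. by move=> muP; rewrite -[in LHS](perm1 a) (on_piece_symm (tree_aut1 T) muP). Qed.

Lemma image_triple (h h1 h2 h3 : V -> V) (P : set V) :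
  (forall v, h v = h1 (h2 (h3 v))) -> h @` P = h1 @` (h2 @` (h3 @` P)).
Proof. by move=> hE; rewrite !image_comp; congr (_ @` P); apply/funext. Qed.

(** Permutations compose by (t * u) a = u (t a), so the outer symmetry contributes the right
    factor. *)
Lemma fiber_comp t u mu nu f : tree_aut t -> tree_aut u -> balanced mu -> balanced nu ->
  natural_map_fiber t f -> natural_map_fiber (t * u)%g (symm u mu \o f \o symm 1%g nu).
Proof.
move=> tP uP muP nuP [[[f0 [U [Uo U0 fU]] [g [g0 [W [Wo W0 gW]] gf fg]]] ff] ft].
have t1 := tree_aut1 T.
have pre (A : {linear V -> V}) S : open S -> open (A @^-1` S).
  by move=> So; apply: open_comp => // x _; exact: linear_rV_continuous.
split; [split; [split|]|].
- by rewrite /= !(linear0, f0).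
- exists (symm 1%g nu @^-1` U); split; [exact: pre | by rewrite /= linear0 |].
  exact: smooth_on_linear.
- exists (symm 1^-1 (inv_weight 1 nu) \o g \o symm u^-1 (inv_weight u mu)); split.
  + by rewrite /= !(linear0, g0).
  + exists (symm u^-1 (inv_weight u mu) @^-1` W); split; [exact: pre | by rewrite /= linear0 |].
    exact: smooth_on_linear.
  + apply: filterS (near0_linear (symm 1%g nu) gf) => x /= xE.
    by rewrite (symmK uP muP) xE (symmK t1 nuP).
  + apply: filterS (near0_linear (symm u^-1 (inv_weight u mu)) fg) => x /= xE.
    by rewrite (symmVK t1 nuP) xE (symmVK uP muP).
- have := near0_linear (symm 1%g nu) (open_nbhs_nbhs (conj Uo U0)).
  apply: filterS2 (near0_linear (symm 1%g nu) ff) => x [xf xc] Ux.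
  split=> [|P].
    by rewrite (front_symm x t1 nuP) xf (front_symm _ uP muP).
  rewrite (coorientation_symm x P t1 nuP) xc (coorientation_symm _ _ uP muP).
  suff dh v : 'd (symm u mu \o f \o symm 1%g nu) x v =
      symm u mu ('d f (symm 1%g nu x) (symm 1%g nu v)).
    by rewrite (image_triple P dh).
  have df : differentiable f (symm 1%g nu x) by exact: (fU [::]).
  have dh : differentiable (symm u mu \o f \o symm 1%g nu) x.
    exact: (iter_derive_linear (symm u mu) [::] Uo fU Ux).2.
  apply: (etrans (esym (deriveE v dh))).
  apply: (etrans (derive_comp_linear (symm 1%g nu) (symm u mu \o f) x v)).
  apply: (etrans (derive_linear_comp (symm u mu) _ df)).
  by congr (symm u mu _); exact: deriveE.
- move=> a a0.
  apply: filterS (near0_linear (symm 1%g nu) (ft a a0)) => x xE.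
  have tua : (t * u)%g a != root by rewrite permM !nonroot_aut.
  rewrite smooth_pieceE // smooth_pieceE // permM /= (on_piece_symm uP muP).
  by move: xE; rewrite !smooth_pieceE ?nonroot_aut // on_piece_symm1.
Qed.

Lemma fiber_id : natural_map_fiber 1%g (id : V -> V).
Proof.
have sm : smooth_germ (id : V -> V).
  by exists setT; split=> //; [exact: openT | exact: (linear_smooth idfun)].
have nid : germ_eq (id \o id : V -> V) id
  by apply: (@filterE _ (nbhs (0 : V)) _ (fun x => id x = x)).
split; [split; [by split=> //; exists id|]|].
  apply: (@filterE _ (nbhs (0 : V))) => x; split=> // P.
  suff -> : 'd id x @` P = P by [].
  by rewrite (linear_rV_diff idfun x) image_id.
by move=> a a0; apply: (@filterE _ (nbhs (0 : V))) => x; rewrite perm1.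
Qed.

Lemma balanced1 : balanced (fun _ : T => 1 : R).
Proof. by split=> // *; rewrite expr1n. Qed.

Lemma symm1_id : symm 1%g (fun _ : T => 1 : R) = id.
Proof. by apply/funext => x; apply/rowP => j; rewrite mxE invg1 perm1 mul1r coord_vtx. Qed.

Lemma fiber_symm t : tree_aut t -> natural_map_fiber t (symm t (fun _ : T => 1 : R)).
Proof.
move=> tP; have := fiber_comp (tree_aut1 T) tP balanced1 balanced1 fiber_id.
by rewrite mul1g symm1_id.
Qed.

End FiberSymmetries.


(** * Convergence within a subset and uniformity over compact sets *)

Section Convergence.
Variable R : realType.

Lemma cvg_sum_seq (T K : Type) (F : set_system T) (FF : Filter F) (W : normedModType R)
    (s : seq K) (h : K -> T -> W) (l : K -> W) :
  (forall k, h k x @[x --> F] --> l k) ->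
  (\sum_(k <- s) h k x) @[x --> F] --> \sum_(k <- s) l k.
Proof.
move=> hl; elim: s => [|k s IH].
  by rewrite big_nil; under eq_cvg do rewrite big_nil; exact: cvg_cst.
by rewrite big_cons; under eq_cvg do rewrite big_cons; exact: cvgD.
Qed.

Lemma cvg_rV (T : Type) (F : set_system T) (FF : Filter F) n
    (h : T -> 'rV[R]_n) (l : 'rV[R]_n) :
  (forall j, h x 0 j @[x --> F] --> l 0 j) -> h x @[x --> F] --> l.
Proof.
move=> hl; apply/cvgrPdist_le => e e0.
have : \forall x \near F, forall j, `|l 0 j - h x 0 j| <= e.
  by apply: filter_forall => j; move/cvgrPdist_le : (hl j); apply.
apply: filterS => x hx; apply: rV_norm_le => [|j]; first exact: ltW.
by rewrite !mxE.
Qed.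

Lemma cvg_within_comp (X Y W : topologicalType) (A : set X) (B : set Y) (psi : X -> Y)
    (h : Y -> W) x :
  psi @ nbhs x --> psi x -> (\forall y \near x, A y -> B (psi y)) ->
  h @ within B (nbhs (psi x)) --> h (psi x) ->
  h (psi y) @[y --> within A (nbhs x)] --> h (psi x).
Proof.
move=> psix AB hB P /hB hP; change (nbhs x (fun y => A y -> P (h (psi y)))).
near=> y => Ay.
have By : B (psi y) by move: Ay; near: y; exact: AB.
move: By; change ((fun w => B w -> P (h w)) (psi y)).
by near: y; exact: psix _ hP.
Unshelve. all: by end_near. Qed.

Lemma coord_cvg (T : Type) (F : set_system T) (FF : Filter F) n
    (h : T -> 'rV[R]_n) (l : 'rV[R]_n) j :
  h @ F --> l -> h x 0 j @[x --> F] --> l 0 j.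
Proof.
move=> hl; exact: (@cvg_comp _ _ _ h (fun v : 'rV[R]_n => v 0 j) F (nbhs l)
  (nbhs (l 0 j)) hl (@coord_continuous _ _ _ 0 j l)).
Qed.

Lemma continuous_compact_bounded (X : topologicalType) (S : set X) (h : X -> R) :
  compact S -> {within S, continuous h} -> exists C : R, forall z, S z -> `|h z| <= C.
Proof.
move=> Sc hS; have /compact_bounded[M [Mr HM]] := continuous_compact hS Sc.
by exists (M + 1) => z Sz; apply: (HM (M + 1)); [rewrite ltrDl | exists z].
Qed.

(** A tube argument: both values are compared with [h (z, 0)] at a centre of a covering of [S], and
    compactness makes the radius in [y] common. *)
Lemma uniform_continuity0 (X : topologicalType) (V : normedModType R) (S : set X)
    (U : set V) (h : X * V -> R) :
  compact S -> open U -> U 0 -> {within S `*` U, continuous h} ->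
  forall e : R, 0 < e -> exists2 d : R, 0 < d &
    forall z y, S z -> `|y| < d -> `|h (z, y) - h (z, 0)| <= e.
Proof.
move=> Sc Uo U0 /subspace_continuousP hc e e0.
have e2 : 0 < e / 2 by rewrite divr_gt0.
have : \forall y \near (0 : V), S `<=` (fun z => `|h (z, y) - h (z, 0)| <= e).
  move/compact_near_coveringP/near_covering_withinP : Sc; apply => z Sz.
  have /cvgrPdist_le/(_ _ e2) := hc (z, 0) (conj Sz U0).
  case=> -[A B] /= [zA B0] AB.
  exists (A, B `&` U); first by split=> //; apply: filterI => //; exact: open_nbhs_nbhs.
  move=> [z' y] [/= Az' [By Uy]] Sz'.
  have h1 : `|h (z, 0) - h (z', y)| <= e / 2 by apply: (AB (z', y)).
  have h2 : `|h (z, 0) - h (z', 0)| <= e / 2.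
    by apply: (AB (z', 0)) => //; split=> //=; exact: nbhs_singleton.
  have -> : h (z', y) - h (z', 0) = (h (z, 0) - h (z', 0)) - (h (z, 0) - h (z', y)) by ring.
  by apply: le_trans (ler_normB _ _) _; rewrite [leRHS]splitr lerD.
move=> /nbhs_normP[d /= d0 dP]; exists d => // z y Sz yd.
by apply: (dP y) => //=; rewrite sub0r normrN.
Qed.

End Convergence.

(** * Polar coordinates on the ball *)

Section Sphere.
Variables (R : realType) (m : nat).
Implicit Type z : 'rV[R]_m.

Definition enorm z : R := Num.sqrt (\sum_i z 0 i ^+ 2).
Definition direction z : 'rV[R]_m := (enorm z)^-1 *: z.

Lemma sum_sqr_ge0 z : 0 <= \sum_i z 0 i ^+ 2.
Proof. by apply: sumr_ge0 => i _; exact: sqr_ge0. Qed.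

Lemma enorm_ge0 z : 0 <= enorm z.
Proof. exact: sqrtr_ge0. Qed.

Lemma enorm_sqr z : enorm z ^+ 2 = \sum_i z 0 i ^+ 2.
Proof. by rewrite sqr_sqrtr // sum_sqr_ge0. Qed.

Lemma enorm_ball z : unit_ball z -> enorm z <= 1.
Proof. by rewrite /unit_ball /= -enorm_sqr expr_le1 // enorm_ge0. Qed.

Lemma enorm_sphere z : unit_sphere z -> enorm z = 1.
Proof. by rewrite /unit_sphere /= /enorm => ->; rewrite sqrtr1. Qed.

Lemma direction_sphere z : unit_sphere z -> direction z = z.
Proof. by move=> /enorm_sphere z1; rewrite /direction z1 invr1 scale1r. Qed.

Lemma direction_in_sphere z : enorm z != 0 -> unit_sphere (direction z).
Proof.
move=> z0; rewrite /unit_sphere /= /direction.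
under eq_bigr do rewrite mxE exprMn.
by rewrite -mulr_sumr -enorm_sqr -exprMn mulVf // expr1n.
Qed.

Lemma sum_sqr_continuous : continuous (fun z => \sum_i z 0 i ^+ 2).
Proof.
move=> z; apply: (@cvg_sum_seq R _ _ (nbhs z) (nbhs_filter z) _ _
  (fun i (z : 'rV[R]_m) => z 0 i ^+ 2)) => i.
by apply: cvgM; exact: coord_continuous.
Qed.

Lemma enorm_continuous : continuous enorm.
Proof.
move=> z; apply: continuous_comp; first exact: sum_sqr_continuous.
exact: sqrt_continuous.
Qed.

Lemma direction_continuous z : enorm z != 0 -> {for z, continuous direction}.
Proof.
move=> z0.
have rV : (enorm y)^-1 @[y --> nbhs z] --> (enorm z)^-1.
  apply: (@cvgV _ _ (nbhs z) (nbhs_filter z) enorm _ z0).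
  exact: (@enorm_continuous z).
exact: (cvgZ rV (@cvg_id _ (nbhs z))).
Qed.

Lemma sphere_compact : compact (@unit_sphere R m).
Proof.
apply: bounded_closed_compact.
  exists 1; split=> // M M1 z zS; apply: ltW; apply: le_lt_trans M1.
  apply: rV_norm_le => // i; rewrite -(@ler_pXn2r _ 2) ?nnegrE // expr1n.
  rewrite -normrX ger0_norm ?sqr_ge0 // -zS (bigD1 i) //= lerDl.
  by apply: sumr_ge0 => j _; exact: sqr_ge0.
have -> : @unit_sphere R m = (fun z => \sum_i z 0 i ^+ 2) @^-1` [set 1] by [].
by apply: (continuous_closedP _).1; [exact: sum_sqr_continuous | exact: closed_eq].
Qed.

End Sphere.


(** * Extension to the ball *)

Section ConeFamily.
Variables (R : realType) (T : signed_rooted_tree) (t : {perm T}) (m : nat).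
Local Notation V := ('rV[R]_#|{: nonroot T}|).
Local Notation I := ('I_#|{: nonroot T}|).
Local Notation root := (Defs.root T).
Local Notation coord := (@Defs.coord R T).
Local Notation sphere := (@unit_sphere R m).
Local Notation wg := (@wgt T).
Variable F : 'rV[R]_m -> V -> V.
Hypothesis tP : tree_aut t.
Hypothesis F_fiber : forall z, sphere z -> natural_map_fiber t (F z).
Implicit Types (z : 'rV[R]_m) (x y v : V) (i j : I) (B : seq I) (r : R) (mu : T -> R).

(* The factor [lead ^ (r - 1)] is 1 for [r = 1] and turns the leading part    *)
(* [symm t lead] of a germ into [symm t 1] for [r = 0].                       *)
Definition lead_factor r (c : R) : R := expR ((r - 1) * ln c).

Definition cone_weight r mu (a : T) : R := lead_factor r (mu a) / r ^+ weight a.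

(** Polar extension with r = [enorm z]. The value at the centre does not involve [F], which also
    covers m = 0, where the sphere is empty. *)
Definition cone z : V -> V :=
  if enorm z == 0 then symm t (fun=> 1)
  else symm 1%g (cone_weight (enorm z) (lead t (F (direction z)))) \o
       F (direction z) \o symm 1%g (@dilw R T (enorm z)).

Lemma cone_weight_balanced r mu : 0 < r -> balanced mu -> balanced (cone_weight r mu).
Proof.
move=> r0 [mu0 muE]; split=> [a a0|a p c d q aE].
  by rewrite divr_gt0 ?expR_gt0 ?exprn_gt0.
have d0 : d != root.
  by apply: (@root_path_split_nonroot T a (rcons p c) d q); rewrite cat_rcons.
rewrite /cone_weight expr_div_n -exprM mulnC -(weight_edge aE); congr (_ / _).
rewrite /lead_factor (muE _ _ _ _ _ aE) lnXn ?mu0 // -expRM_natl; congr expR.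
by rewrite mulr2n; ring.
Qed.

Lemma cone_fiber z : natural_map_fiber t (cone z).
Proof.
rewrite /cone; case: eqVneq => [_|z0]; first exact: fiber_symm.
have Fz := F_fiber (direction_in_sphere z0).
have r0 : 0 < enorm z by rewrite lt_neqAle eq_sym z0 enorm_ge0.
rewrite -[t in natural_map_fiber t _]mulg1; apply: fiber_comp => //.
- exact: tree_aut1.
- by apply: cone_weight_balanced => //; exact: lead_balanced.
- exact: dilw_balanced.
Qed.

Lemma cone_sphere z : sphere z -> cone z = F z.
Proof.
move=> zS; have z1 := enorm_sphere zS.
have -> : F z = symm 1%g (fun=> 1) \o F z \o symm 1%g (fun=> 1) by rewrite symm1_id.
rewrite /cone z1 oner_eq0 (direction_sphere zS); congr (symm _ _ \o _ \o symm _ _).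
  by apply/funext => a; rewrite /cone_weight /lead_factor subrr mul0r expR0 expr1n divr1.
by apply/funext => a; rewrite /dilw expr1n.
Qed.

Section CommonNeighbourhood.
Variables (U : set V) (rho : R).
Hypotheses (Uo : open U) (U0 : U 0) (FU : forall z, sphere z -> smooth_on U (F z)).
Hypothesis Fc : forall vs, {within sphere `*` U,
  continuous (fun q : 'rV[R]_m * V => iter_derive vs (F q.1) q.2)}.
Hypotheses (rho0 : 0 < rho) (rho1 : rho <= 1) (rhoU : forall x, `|x| < rho -> U x).

Let ball_rho : set V := [set x | `|x| < rho].

Lemma open_ball_rho : open ball_rho.
Proof.
have -> : ball_rho = ball_ Num.norm 0 rho.
  by apply/seteqP; split=> x; rewrite /ball_rho /ball_ /= sub0r normrN.
by rewrite ball_normE; exact: ball_open.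
Qed.

Lemma dil_ball r x : 0 <= r <= 1 -> `|x| < rho -> `|dil wg r x| < rho.
Proof.
move=> r01; apply: le_lt_trans; apply: le_trans (norm_dil (@wgt_gt0 T) x r01) _.
by rewrite ler_piMl //; case/andP: r01.
Qed.

Lemma enorm01 z : unit_ball z -> 0 <= enorm z <= 1.
Proof. by move=> zb; rewrite enorm_ge0 enorm_ball. Qed.

(** Chain rule: the inner dilation contributes r^(wt B) and the outer one r^-(wg j), the quotient
    controlled by [uniform_scaling]. *)
Lemma partial_cone z B x j : unit_ball z -> enorm z != 0 -> `|x| < rho ->
  partial B (cone z) x 0 j =
  lead_factor (enorm z) (lead t (F (direction z)) (vtx j)) *
  (enorm z ^+ wt wg B / enorm z ^+ wg j *
   partial B (F (direction z)) (dil wg (enorm z) x) 0 j).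
Proof.
move=> zb z0 xr; have FzU := FU (direction_in_sphere z0).
have UD : U (symm 1%g (@dilw R T (enorm z)) x).
  by rewrite -dilE; apply/rhoU/dil_ball => //; exact: enorm01.
rewrite /cone (negPf z0) /partial.
have [-> _] := iter_derive_linear (symm 1%g (cone_weight (enorm z) (lead t (F (direction z)))))
  (B := symm 1%g (@dilw R T (enorm z))) [seq delta_mx 0 i | i <- B] Uo FzU UD.
have -> : [seq symm 1%g (@dilw R T (enorm z)) v | v <- [seq delta_mx 0 i | i <- B]] =
    [seq enorm z ^+ wg i *: (delta_mx 0 i : V) | i <- B].
  rewrite -map_comp; apply: eq_map => i /=; rewrite -dilE; apply/rowP => k.
  by rewrite !mxE eqxx /=; case: eqVneq => [->|]; rewrite ?mulr0.
rewrite (iter_derive_scale (fun i => enorm z ^+ wg i) B Uo FzU UD) prodrXr linearZ /=.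
rewrite mxE mxE invg1 perm1 coord_vtx -dilE /cone_weight -/(wg j).
by rewrite -!mulrA mulrCA.
Qed.

Definition symm_partial B x i0 : R := if B is [::] then x 0 i0 else (B == [:: i0])%:R.

Lemma partial_symm B x i0 j : vtx j = t (vtx i0) ->
  partial B (symm t (fun=> 1)) x 0 j = symm_partial B x i0.
Proof.
move=> jE; have sE y : symm t (fun=> 1) y 0 j = y 0 i0.
  by rewrite mxE mul1r jE permK coord_vtx.
case: B => [|i B]; first exact: sE.
have D1 v (y : V) : 'D_v (symm t (fun=> 1)) y = symm t (fun=> 1) v.
  by rewrite -[symm t _]/(id \o symm t _) derive_comp_linear derive_id.
elim/last_ind: B => [|B k _].
  rewrite /partial /= D1 sE mxE eqxx /= eqseq_cons andbT eq_sym.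
  by [].
have D2 vs v v' y : iter_derive (rcons (v :: vs) v') (symm t (fun=> 1)) y = 0.
  elim: vs v y => [|v1 vs IH] v y /=; first by
    rewrite (_ : (fun w : V => _) = cst (symm t (fun=> 1) v')) ?derive_cst //; apply/funext.
  rewrite (_ : (fun w : V => 'D_v1 _ w) = cst 0); first exact: derive_cst.
  by apply/funext => w; exact: IH.
rewrite /partial map_cons map_rcons -rcons_cons D2 mxE /symm_partial eqseq_cons.
by case: (B) => [|? ?]; rewrite andbF.
Qed.

Lemma cone_smooth z : unit_ball z -> smooth_on ball_rho (cone z).
Proof.
move=> zb; rewrite /cone; case: eqVneq => [_|z0].
  apply: (@smooth_on_subset R _ _ setT) => //.
  exact: linear_smooth.
apply: smooth_on_subset (smooth_on_linear _ Uo (FU (direction_in_sphere z0))) => x xr.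
by rewrite /preimage /= -dilE; apply/rhoU/dil_ball => //; exact: enorm01.
Qed.

Section OneComponent.
Variables (i0 j : I).
Hypothesis jE : vtx j = t (vtx i0).
Local Notation g B z y := (partial B (F z) y 0 j).

Lemma lead_partial z : lead t (F z) (vtx j) = g [:: i0] z 0.
Proof. exact: lead_vtx. Qed.

Lemma lead_gt0 z : sphere z -> 0 < lead t (F z) (vtx j).
Proof. by move=> /F_fiber/(lead_balanced tP)[+ _]; apply; exact: vtx_nonroot. Qed.

Lemma wgt_aut : wg j = wg i0.
Proof. by rewrite /wgt /weight jE root_path_aut // size_map. Qed.

Lemma partial_within B : {within sphere `*` U,
  continuous (fun q : 'rV[R]_m * V => g B q.1 q.2)}.
Proof.
apply/subspace_continuousP => q Aq; apply: coord_cvg.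
have /subspace_continuousP H := @Fc [seq (delta_mx 0 i : V) | i <- B].
exact: H.
Qed.

Lemma partial0_within B : {within sphere, continuous (fun z => g B z 0)}.
Proof.
apply/subspace_continuousP => z Sz.
apply: (@cvg_within_comp _ _ _ sphere (sphere `*` U) (fun z => (z, 0 : V))
  (fun q => g B q.1 q.2)).
- exact: (@cvg_pair _ _ _ (nbhs z) (nbhs z) (nbhs (0 : V)) _ _ _ id (fun=> 0)
    cvg_id (cvg_cst _)).
- by apply: (@filterE _ (nbhs z)) => z' Sz'; split.
- by have /subspace_continuousP H := @partial_within B; apply: H; split.
Qed.

Arguments partial_within : clear implicits.
Arguments partial0_within : clear implicits.

Lemma ln_lead_within : {within sphere, continuous (fun z => ln (lead t (F z) (vtx j)))}.
Proof.
apply/subspace_continuousP => z Sz.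
have c0 := lead_gt0 Sz.
have lc : lead t (F y) (vtx j) @[y --> within sphere (nbhs z)] --> lead t (F z) (vtx j).
  under eq_fun do rewrite lead_partial; rewrite lead_partial.
  have /subspace_continuousP H := partial0_within [:: i0].
  exact: H.
exact: (@cvg_comp _ _ _ (fun w => lead t (F w) (vtx j)) (@ln R) _ _ _ lc (continuous_ln c0)).
Qed.

(** The rescaled derivative tends to c times that of the permutation, uniformly over directions, and
    c^(r-1) c = c^r tends to 1, uniformly since ln c is bounded on the compact sphere. *)
Lemma cone_cvg0 B (x0 : V) (z0 : 'rV[R]_m) : enorm z0 = 0 -> `|x0| < rho ->
  partial B (cone q.1) q.2 0 j @[q --> within (@unit_ball R m `*` ball_rho) (nbhs (z0, x0))]
    --> partial B (cone z0) x0 0 j.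
Proof.
move=> r0 x0r; have cone0 z x : enorm z = 0 -> partial B (cone z) x 0 j = symm_partial B x i0.
  by move=> z00; rewrite /cone z00 eqxx (partial_symm _ _ jE).
rewrite cone0 //; apply/cvgrPdist_le => /= e e0.
have [Lam LamP] := continuous_compact_bounded (@sphere_compact R m) ln_lead_within.
have e2 : 0 < e / 2 by rewrite divr_gt0.
have e4 : 0 < e / 4 by rewrite divr_gt0.
(* Bounds every factor c^(r-1) with 0 < r <= 1, as |r - 1| <= 1 and |ln c| <= |Lam|. *)
pose M := expR `|Lam|.
have M0 : 0 < M by exact: expR_gt0.
have e5 : 0 < e / 4 / M by rewrite divr_gt0.
have sc : \forall r \near (0 : R)^'+, forall z x, sphere z -> `|x| < rho ->
    `|r ^+ wt wg B / r ^+ wg i0 * g B z (dil wg r x) -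
      scaling_limit F i0 j B z x| <= e / 4 / M.
  apply: (uniform_scaling (@wgt_gt0 T) rho1) => //.
  - by move=> z C x Sz xr; apply: (FU Sz); exact: rhoU.
  - move=> C e' e'0.
    exact: (uniform_continuity0 (@sphere_compact R m) Uo U0 (partial_within C) e'0).
  - by move=> C; exact: continuous_compact_bounded (@sphere_compact R m) (partial0_within C).
  - move=> z C Sz wC Ci; have [_ ft] := F_fiber Sz.
    exact: (partial_vanish tP ft Uo U0 (FU Sz) jE wC Ci).
have ex : \forall r \near (0 : R)^'+, forall c : R, `|c| <= `|Lam| -> `|expR (r * c) - 1| <= e / 4.
  have /cvgrPdist_le/(_ _ e4)/nbhs_normP[d /= d0 dP] := @continuous_expR R 0.
  near=> r => c cL.
  have rp : 0 < r by near: r; exact: nbhs_right_gt.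
  suff /dP : ball_ Num.norm 0 d (r * c) by rewrite /= expR0 distrC.
  rewrite /ball_ /= sub0r normrN normrM gtr0_norm //.
  have : r < d / (`|Lam| + 1).
    by near: r; apply: nbhs_right_lt; rewrite divr_gt0 // ltr_wpDl.
  rewrite ltr_pdivlMr ?ltr_wpDl //; apply: le_lt_trans.
  by rewrite ler_wpM2l ?(ltW rp) // (le_trans cL) // lerDl.
have main : \forall r \near (0 : R)^'+, forall z x, unit_ball z -> enorm z = r -> `|x| < rho ->
    `|partial B (cone z) x 0 j - symm_partial B x i0| <= e / 2.
  near=> r => z x zb zr xr.
  have scr : forall z x, sphere z -> `|x| < rho ->
      `|r ^+ wt wg B / r ^+ wg i0 * g B z (dil wg r x) -
        scaling_limit F i0 j B z x| <= e / 4 / M by near: r; exact: sc.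
  have exr : forall c : R, `|c| <= `|Lam| -> `|expR (r * c) - 1| <= e / 4.
    by near: r; exact: ex.
  have rp : 0 < r by near: r; exact: nbhs_right_gt.
  have r1 : r <= 1 by near: r; exact: nbhs_right_le.
  have z00 : enorm z != 0 by rewrite zr gt_eqF.
  have Sd := direction_in_sphere z00.
  rewrite partial_cone // zr wgt_aut.
  set c := lead t _ _; have c0 : 0 < c by exact: lead_gt0.
  have lnc : `|ln c| <= `|Lam| by apply: le_trans (LamP _ Sd) _; exact: ler_norm.
  set Q := _ * g B _ _; have QL : `|Q - scaling_limit F i0 j B (direction z) x| <= e / 4 / M.
    exact: scr.
  have LE : scaling_limit F i0 j B (direction z) x = c * symm_partial B x i0.
    rewrite /scaling_limit /symm_partial /c lead_partial.
    by case: (B) => [|? ?]; [rewrite mulrC | case: ifP => _; rewrite ?mulr1 ?mulr0].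
  have lamc : lead_factor r c * c = expR (r * ln c).
    rewrite /lead_factor -{2}(lnK (x := c)) ?posrE // -expRD; congr expR; ring.
  have lam0 : 0 < lead_factor r c by exact: expR_gt0.
  have lamM : lead_factor r c <= M.
    rewrite ler_expR; apply: le_trans (ler_norm _) _; rewrite normrM.
    have r11 : `|r - 1| <= 1 by rewrite ler_norml; apply/andP; split; lra.
    by rewrite -[leRHS]mul1r ler_pM.
  have sp1 : `|symm_partial B x i0| <= 1.
    rewrite /symm_partial; case: (B) => [|? ?].
      by apply: le_trans (rV_coord_norm_le _ _) _; rewrite (le_trans (ltW xr)).
    by case: eqP => _; rewrite ?normr1 ?normr0.
  (* The scaling error times c^(r-1), plus the error c^r - 1 times a limit derivative of size at
     most 1; each is at most e/4. *)
  have -> : lead_factor r c * Q - symm_partial B x i0 =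
      lead_factor r c * (Q - scaling_limit F i0 j B (direction z) x) +
      (expR (r * ln c) - 1) * symm_partial B x i0.
    by rewrite LE -lamc; ring.
  apply: le_trans (ler_normD _ _) _; rewrite !normrM (gtr0_norm lam0).
  have -> : e / 2 = M * (e / 4 / M) + e / 4 * 1 by field; rewrite gt_eqF.
  apply: lerD; first by apply: ler_pM => //; exact: ltW.
  by apply: ler_pM => //; exact: exr.
have [d /= d0 dP] : exists2 d : R, 0 < d & forall r, 0 < r < d -> forall z x,
    unit_ball z -> enorm z = r -> `|x| < rho ->
    `|partial B (cone z) x 0 j - symm_partial B x i0| <= e / 2.
  case: main => d /= d0 dP; exists d => // r /andP[rp rd].
  by apply: dP => //=; rewrite sub0r normrN gtr0_norm.
have xnear : \forall x \near x0, `|symm_partial B x0 i0 - symm_partial B x i0| <= e / 2.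
  rewrite /symm_partial; case: (B) => [|? ?].
    by have /cvgrPdist_le := @coord_continuous _ _ _ 0 i0 x0; exact.
  by apply: (@filterE _ (nbhs x0)) => x; rewrite subrr normr0 ltW.
have znear : \forall z \near z0, enorm z < d.
  have /cvgrPdist_lt/(_ _ d0) := @enorm_continuous R m z0.
  apply: (@filterS _ (nbhs z0)) => z; rewrite r0 sub0r normrN.
  exact: le_lt_trans (ler_norm _).
exists ([set z | enorm z < d],
  [set x | `|symm_partial B x0 i0 - symm_partial B x i0| <= e / 2]) => //.
move=> [z x] /= [zd xd] [zb xr].
have [z00|z00] := eqVneq (enorm z) 0.
  by rewrite cone0 //; apply: le_trans xd _; rewrite ler_pdivrMr // ler_peMr ?ltW // ltr1n.
have zpos : 0 < enorm z < d by rewrite lt_neqAle eq_sym z00 enorm_ge0.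
have := dP _ zpos z x zb erefl xr; rewrite distrC => h.
rewrite -(subrK (symm_partial B x i0) (symm_partial B x0 i0)) -addrA.
by apply: le_trans (ler_normD _ _) _; rewrite [leRHS]splitr lerD.
Unshelve. all: by end_near. Qed.

(** Away from the centre the norm is invertible and the direction continuous, so the formula of
    [partial_cone] is a composite of continuous maps. *)
Lemma cone_cvg_pos B (x0 : V) (z0 : 'rV[R]_m) : unit_ball z0 -> enorm z0 != 0 ->
  `|x0| < rho ->
  partial B (cone q.1) q.2 0 j @[q --> within (@unit_ball R m `*` ball_rho) (nbhs (z0, x0))]
    --> partial B (cone z0) x0 0 j.
Proof.
move=> z0b r0 x0r; set A := _ `*` _.
have fstc : (@fst 'rV[R]_m V) @ nbhs (z0, x0) --> z0 by exact: cvg_fst.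
have sndc : (@snd 'rV[R]_m V) @ nbhs (z0, x0) --> x0 by exact: cvg_snd.
have rc : enorm q.1 @[q --> nbhs (z0, x0)] --> enorm z0.
  exact: (@cvg_comp _ _ _ fst (@enorm R m) _ _ _ fstc (@enorm_continuous R m z0)).
have dc : direction q.1 @[q --> nbhs (z0, x0)] --> direction z0.
  exact: (@cvg_comp _ _ _ fst (@direction R m) _ _ _ fstc (direction_continuous r0)).
have powc k : enorm q.1 ^+ k @[q --> nbhs (z0, x0)] --> enorm z0 ^+ k.
  exact: (@cvg_comp _ _ _ _ (fun r => r ^+ k) _ _ _ rc (@exprn_continuous _ k _)).
have dilc : dil wg (enorm q.1) q.2 @[q --> nbhs (z0, x0)] --> dil wg (enorm z0) x0.
  apply: cvg_rV => k; rewrite mxE.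
  have -> : (fun q : 'rV[R]_m * V => dil wg (enorm q.1) q.2 0 k) =
      (fun q => enorm q.1 ^+ wg k * q.2 0 k) by apply/funext => q; rewrite mxE.
  by apply: cvgM; [exact: powc | exact: coord_cvg].
have neq0 : \forall q \near nbhs (z0, x0), enorm q.1 != 0.
  exact: (cvgr_neq0 _ rc r0).
pose E (q : 'rV[R]_m * V) : R :=
  expR ((enorm q.1 - 1) * ln (lead t (F (direction q.1)) (vtx j))) *
  (enorm q.1 ^+ wt wg B / enorm q.1 ^+ wg j *
   g B (direction q.1) (dil wg (enorm q.1) q.2)).
have EE q : A q -> enorm q.1 != 0 -> partial B (cone q.1) q.2 0 j = E q.
  by case: q => z x [zb xr] rq; exact: partial_cone.
rewrite (EE (z0, x0)) //.
have nearE : {near within A (nbhs (z0, x0)), E =1 (fun q => partial B (cone q.1) q.2 0 j)}.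
  apply: (@filterS _ (nbhs (z0, x0)) _ _ _ _ neq0) => q rq Aq; rewrite EE //.
apply: (cvg_trans (near_eq_cvg nearE)).
have lnc : ln (lead t (F (direction q.1)) (vtx j)) @[q --> within A (nbhs (z0, x0))]
    --> ln (lead t (F (direction z0)) (vtx j)).
  apply: (@cvg_within_comp _ _ _ A sphere (fun q => direction q.1)
    (fun z => ln (lead t (F z) (vtx j))) (z0, x0)) => //.
    apply: (@filterS _ (nbhs (z0, x0)) _ _ _ _ neq0) => q rq _.
    exact: direction_in_sphere.
  have /subspace_continuousP H := ln_lead_within.
  by apply: H; exact: direction_in_sphere.
have gc : g B (direction q.1) (dil wg (enorm q.1) q.2) @[q --> within A (nbhs (z0, x0))]
    --> g B (direction z0) (dil wg (enorm z0) x0).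
  apply: (@cvg_within_comp _ _ _ A (sphere `*` U)
    (fun q => (direction q.1, dil wg (enorm q.1) q.2))
    (fun q => g B q.1 q.2) (z0, x0)).
  - exact: (@cvg_pair _ _ _ (nbhs (z0, x0)) _ _ _ _ _ _ _ dc dilc).
  - apply: (@filterS _ (nbhs (z0, x0)) _ _ _ _ neq0) => -[z x] /= rq [zb xr].
    split; first exact: direction_in_sphere.
    by apply/rhoU/dil_ball => //; exact: enorm01.
  - have /subspace_continuousP H := @partial_within B.
    apply: H; split; first exact: direction_in_sphere.
    by apply/rhoU/dil_ball => //; exact: enorm01.
have rcA : enorm q.1 @[q --> within A (nbhs (z0, x0))] --> enorm z0.
  exact: cvg_within_filter.
have powcA k : enorm q.1 ^+ k @[q --> within A (nbhs (z0, x0))] --> enorm z0 ^+ k.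
  exact: cvg_within_filter.
apply: cvgM.
  have arg : (enorm q.1 - 1) * ln (lead t (F (direction q.1)) (vtx j))
      @[q --> within A (nbhs (z0, x0))] -->
      (enorm z0 - 1) * ln (lead t (F (direction z0)) (vtx j)).
    by apply: cvgM => //; apply: cvgB => //; exact: cvg_cst.
  exact: (@cvg_comp _ _ _ _ (@expR R) _ _ _ arg (@continuous_expR R _)).
apply: cvgM => //; apply: cvgM => //; apply: cvgV => //.
by rewrite expf_neq0.
Qed.

Lemma partial_cone_within B : {within @unit_ball R m `*` ball_rho,
  continuous (fun q : 'rV[R]_m * V => partial B (cone q.1) q.2 0 j)}.
Proof.
apply/subspace_continuousP => -[z0 x0] [zb xr].
have [r0|r0] := eqVneq (enorm z0) 0; first exact: cone_cvg0.
exact: cone_cvg_pos.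
Qed.

End OneComponent.

Lemma cone_within vs : {within @unit_ball R m `*` ball_rho,
  continuous (fun q : 'rV[R]_m * V => iter_derive vs (cone q.1) q.2)}.
Proof.
have bo := open_ball_rho.
pose A := @unit_ball R m `*` ball_rho.
have EE q : A q -> iter_derive vs (cone q.1) q.2 =
    \sum_(cB <- expansion vs) cB.1 *: partial cB.2 (cone q.1) q.2.
  by move=> [qb qr]; apply: (iter_derive_expansion _ bo (cone_smooth qb)).
have lim z0 x0 : unit_ball z0 -> `|x0| < rho ->
    iter_derive vs (cone q.1) q.2 @[q --> within A (nbhs (z0, x0))]
      --> iter_derive vs (cone z0) x0.
  move=> zb xr; rewrite (EE (z0, x0)) //.
  have nearE : {near within A (nbhs (z0, x0)), (fun q : 'rV[R]_m * V =>
      \sum_(cB <- expansion vs) cB.1 *: partial cB.2 (cone q.1) q.2) =1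
      (fun q => iter_derive vs (cone q.1) q.2)}.
    by apply: (@filterE _ (nbhs (z0, x0))) => q Aq; rewrite EE.
  apply: (cvg_trans (near_eq_cvg nearE)).
  apply: cvg_sum_seq => -[c B] /=; apply: cvgZ; first exact: cvg_cst.
  apply: cvg_rV => j.
  have [i0 i0E] : exists i0, vtx i0 = t^-1%g (vtx j).
    by apply: vtx_surj; rewrite (nonroot_aut (tree_aut_inv tP)) vtx_nonroot.
  have jE : vtx j = t (vtx i0) by rewrite i0E permKV.
  have /subspace_continuousP H := partial_cone_within jE (B := B).
  by apply: (H (z0, x0)); split.
by apply/subspace_continuousP => -[z0 x0] [zb xr]; exact: lim.
Qed.

(** One ball serves all parameters, because dilations with r <= 1 map it into itself. *)
Lemma cone_smooth_family : smooth_family (@unit_ball R m) cone.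
Proof.
exists ball_rho; split; [exact: open_ball_rho| |exact: cone_smooth|exact: cone_within].
by rewrite /ball_rho /= normr0.
Qed.

End CommonNeighbourhood.
End ConeFamily.

Theorem theorem1p3 (R : realType) (T : signed_rooted_tree) (t : {perm T}) :
  tree_aut t -> weakly_contractible (@natural_map_fiber R T t).
Proof.
move=> tP m F [U [Uo U0 FU Fc]] F_fiber.
have [rho /andP[rho0 rho1] rhoU] := open_ball0 Uo U0.
exists (cone t F); split.
- exact: (cone_smooth_family tP F_fiber Uo U0 FU Fc rho0 rho1 rhoU).
- by move=> z _; exact: cone_fiber.
- by move=> z zS; rewrite cone_sphere //; exact: (@filterE _ (nbhs (0 : 'rV[R]_#|{: nonroot T}|))).
Qed.
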